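(* Let $U$ be a countable set of queries and let $A(D,x)$ be a randomized algorithm taking a dataset $D$ and a query $x\in U$ and outputting a real number; write $A_r(D,x)$ for $A$ run with the random string $r\in\{0,1\}^\infty$ (so $A_r(D,x)$ is a deterministic function of $(D,x,r)$). Let $\Delta_1,\Delta_2\ge 0$. Assume there is a function $g(D,x)$ such that for every $x\in U$ the global sensitivity of $D\mapsto g(D,x)$ is at most $\Delta_1$, i.e. $\sup_{D\sim D'}|g(D,x)-g(D',x)|\le \Delta_1$, and such that $\sigma_{se}[A_r(D,x)-g(D,x)]\le\Delta_2$ for every $D$ and $x$ (over uniformly random $r$). Let $k\ge1$ be an integer, let $c=3+12\log 2$, and let $0<\epsilon\le c/6$. Draw $r$ uniformly from $\{0,1\}^\infty$ and, independently, $Y_1,\dots,Y_k$ i.i.d. $\sim\mathrm{Laplace}(c(\Delta_1+\Delta_2)k/\epsilon)$. Let queries $x_1,\dots,x_k\in U$ be chosen adaptively: $x_i$ is drawn from a distribution which is a function of $A_r(D,x_1)+Y_1,\dots,A_r(D,x_{i-1})+Y_{i-1}$. Then the mechanism releasing $(A_r(D,x_1)+Y_1,\dots,A_r(D,x_k)+Y_k)$ (but not $r$) is $\epsilon$-differentially private, where the probability is also over $r$. Moreover, if $k=1$, the same conclusion holds with $c=1+4\log 2$ and any $0<\epsilon\le c/2$.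
   Context: A symmetric ''neighbor'' relation $\sim$ on datasets is fixed. A randomized algorithm $M$ with range $S$ is $\epsilon$-differentially private if for every measurable $T\subseteq S$ and all $D\sim D'$, $e^{-\epsilon}\le \mathbb{P}[M(D)\in T]/\mathbb{P}[M(D')\in T]\le e^{\epsilon}$. For a real random variable $X$, its subexponential diameter $\sigma_{se}[X]$ is the smallest value such that $\mathbb{P}[|X|\ge t]\le 2\exp(-t/\sigma_{se}[X])$ for all $t>0$. $\mathrm{Laplace}(b)$ denotes the distribution with density $\frac{1}{2b}e^{-|x|/b}$. $\log$ is the natural logarithm. *)

(* Defs.v *)
From HB Require Import structures.
From mathcomp Require Import all_boot all_order all_algebra.
From mathcomp Require Import all_classical all_reals all_analysis.
From mathcomp Require Import measurable_realfun.

Set Implicit Arguments.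
Unset Strict Implicit.
Unset Printing Implicit Defensive.

Import Order.TTheory GRing.Theory Num.Theory.
Import numFieldNormedType.Exports.

Local Open Scope classical_set_scope.
Local Open Scope ring_scope.

(* The sigma-algebra on {0,1}^oo is the product one, generated by the sets
   that fix one coordinate. *)
Definition coordinate_sets : set (set (nat -> bool)) :=
  [set C | exists n b, C = [set r | r n = b]].

Definition random_string := g_sigma_algebraType coordinate_sets.

HB.instance Definition _ := Measurable.on random_string.

(* Cylinders form a pi-system generating the sigma-algebra, so this predicate
   holds of exactly one probability measure. *)
Definition uniform_string (R : realType) (mu : probability random_string R) :=
  forall (n : nat) (s : n.-tuple bool),
    mu [set r : random_string | forall i : 'I_n, r i = tnth s i]
    = (2 ^- n)%:E.

Section laplace.
Context {R : realType}.
Variable b : R.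
Local Notation leb := (@lebesgue_measure R).

Definition laplace_pdf (x : R) : R := (2 * b)^-1 * expR (- (`|x| / b)).

Lemma laplace_pdf_ge0 x : 0 < b -> 0 <= laplace_pdf x.
Proof.
by move=> b0; rewrite mulr_ge0 ?expR_ge0// invr_ge0 mulr_ge0 ?ler0n ?ltW.
Qed.

Lemma continuous_laplace_pdf : continuous laplace_pdf.
Proof.
move=> x.
apply: (@continuousM _ R^o (fun=> (2 * b)^-1) (fun x => expR (- (`|x| / b)))).
  exact: cst_continuous.
apply: continuous_comp; last exact: continuous_expR.
apply: (@continuousN _ R^o).
apply: (@continuousM _ R^o (fun x : R => `|x|) (fun=> b^-1)); last first.
  exact: cst_continuous.
exact: norm_continuous.
Qed.

Lemma measurable_laplace_pdf : measurable_fun [set: R] laplace_pdf.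
Proof. by apply: continuous_measurable_fun; exact: continuous_laplace_pdf. Qed.

Lemma integral_laplace_pdf : 0 < b ->
  (\int[leb]_x (laplace_pdf x)%:E = 1)%E.
Proof.
move=> b0.
have bV0 : 0 < b^-1 by rewrite invr_gt0.
rewrite ge0_symfun_integralT; last 3 first.
- by move=> x; exact: laplace_pdf_ge0.
- exact: continuous_laplace_pdf.
- by move=> x; rewrite /laplace_pdf /= normrN.
pose I : set R := `[0, +oo[%classic.
have -> : (\int[leb]_(x in [set x | (0 <= x)%R]) (laplace_pdf x)%:E =
   \int[leb]_(x in I) ((2^-1)%R%:E * (exponential_pdf b^-1 x)%:E))%E.
  rewrite -set_itvcy; apply: eq_integral => x.
  rewrite inE/= in_itv/= andbT => x0.
  rewrite exponential_pdfE// -EFinM /laplace_pdf ger0_norm// invfM mulrA.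
  by rewrite mulNr [b^-1 * x]mulrC.
rewrite ge0_integralZl//=; last 3 first.
- exact: measurable_itv.
- apply/measurable_EFinP; apply: measurable_funTS.
  exact: measurable_exponential_pdf.
- by move=> x _; rewrite lee_fin exponential_pdf_ge0 ?ltW.
rewrite muleA -EFinM divff// mul1e -(integral_exponential_pdf bV0).
rewrite integral_mkcond; apply: eq_integral => x _.
by rewrite patchE; case: ifPn => // xN; rewrite /exponential_pdf patchE (negbTE xN).
Qed.

(* For b <= 0 (a scale that arises when both sensitivities vanish) the law is
   the point mass at 0, the weak limit of Laplace(b) as b tends to 0. *)
Definition laplace (V : set R) : \bar R :=
  if 0 < b then (\int[leb]_(x in V) (laplace_pdf x)%:E)%E
  else (\d_(0 : R) V)%R.

Let laplace0 : laplace set0 = 0%E.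
Proof. by rewrite /laplace; case: ifP => _; rewrite ?integral_set0// measure0. Qed.

Let laplace_ge0 V : (0 <= laplace V)%E.
Proof.
rewrite /laplace; case: ifPn => // b0.
by apply: integral_ge0 => x _; rewrite lee_fin laplace_pdf_ge0.
Qed.

Let laplace_sigma_additive : semi_sigma_additive laplace.
Proof.
rewrite /laplace; have [b0|b0] := ltP 0 b; last first.
  exact: measure_semi_sigma_additive.
move=> /= F mF tF mUF; apply: cvg_toP.
  apply: ereal_nondecreasing_is_cvgn => m n mn.
  apply: lee_sum_nneg_natr => // k _ _; apply: integral_ge0 => /= x Fkx.
  by rewrite lee_fin laplace_pdf_ge0.
rewrite ge0_integral_bigcup//=.
- apply/measurable_funTS/measurableT_comp => //.
  exact: measurable_laplace_pdf.
- by move=> x _; rewrite lee_fin laplace_pdf_ge0.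
Qed.

HB.instance Definition _ := isMeasure.Build _ _ _
  laplace laplace0 laplace_ge0 laplace_sigma_additive.

Let laplaceT : laplace [set: R] = 1%E.
Proof.
rewrite /laplace; case: ifPn => b0; first exact: integral_laplace_pdf.
by rewrite diracT.
Qed.

HB.instance Definition _ := Measure_isProbability.Build _ _ R
  laplace laplaceT.

End laplace.

Section iid.
Context {d} {T : measurableType d} {R : realType}.

Definition tuple_cons n (p : T * n.-tuple T) : n.+1.-tuple T :=
  [tuple of p.1 :: p.2].

Lemma measurable_tuple_cons n : measurable_fun setT (@tuple_cons n).
Proof. exact: measurable_cons. Qed.

HB.instance Definition _ n :=
  isMeasurableFun.Build _ _ _ _ (@tuple_cons n) (@measurable_tuple_cons n).

Fixpoint iid (P : probability T R) n : probability (n.-tuple T) R :=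
  match n return probability (n.-tuple T) R with
  | 0 => \d_([tuple] : 0.-tuple T)
  | n'.+1 => distribution (P \x iid P n')%E (@tuple_cons n')
  end.

End iid.

Section kernels.
Local Open Scope ereal_scope.

Section pkcomp.
Context d1 d2 d3 (X : measurableType d1) (Y : measurableType d2)
  (Z : measurableType d3) (R : realType).
Variables (l : R.-pker X ~> Y) (k : R.-pker (X * Y) ~> Z).

Definition pkcomp : X -> {measure set Z -> \bar R} := mkcomp l k.

Let measurable_pkcomp V : measurable V ->
  measurable_fun [set: X] (pkcomp ^~ V).
Proof. exact: (measurable_kernel (mkcomp l k)). Qed.

HB.instance Definition _ := isKernel.Build _ _ X Z R pkcomp measurable_pkcomp.

Let pkcomp_prob x : pkcomp x [set: Z] = 1.
Proof.
rewrite /pkcomp /= /kcomp (eq_integral (cst 1)) => [|y _].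
  by rewrite integral_cst// mul1e prob_kernel.
by rewrite prob_kernel.
Qed.

HB.instance Definition _ :=
  Kernel_isProbability.Build _ _ X Z R pkcomp pkcomp_prob.

End pkcomp.

Section kmix.
Context d1 d2 (X : measurableType d1) (Z : measurableType d2) (R : realType).
Variables (P : probability X R) (k : R.-pker X ~> Z).

Definition kmix (V : set Z) : \bar R := \int[P]_x k x V.

Let kmix0 : kmix set0 = 0.
Proof.
by rewrite /kmix (eq_integral (cst 0)) ?integral0// => y _; rewrite measure0.
Qed.

Let kmix_ge0 V : 0 <= kmix V. Proof. exact: integral_ge0. Qed.

Let kmix_sigma_additive : semi_sigma_additive kmix.
Proof.
move=> V mV tV mUV; rewrite [X in _ --> X](_ : _ =
  \int[P]_x (\sum_(n <oo) k x (V n))); last first.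
  apply: eq_integral => x _.
  by apply/esym/cvg_lim => //; exact/measure_semi_sigma_additive.
apply/cvg_closeP; split.
  by apply: is_cvg_nneseries => n _ _; exact: integral_ge0.
rewrite closeE// integral_nneseries// => n.
exact: (measurable_kernel k _ (mV n)).
Qed.

HB.instance Definition _ :=
  isMeasure.Build _ _ R kmix kmix0 kmix_ge0 kmix_sigma_additive.

Let kmix_setT : kmix [set: Z] = 1.
Proof.
rewrite /kmix (eq_integral (cst 1)) => [|y _]; last by rewrite prob_kernel.
by rewrite integral_cst//= mul1e; exact: probability_setT.
Qed.

HB.instance Definition _ := Measure_isProbability.Build _ _ _ kmix kmix_setT.

End kmix.
End kernels.

Lemma measurable_tuple_nth (R : realType) n i :
  measurable_fun [set: n.-tuple R] (fun t : n.-tuple R => t`_i).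
Proof.
have [ni|ni] := ltnP i n; last first.
  rewrite (_ : (fun _ => _) = cst 0); first exact: measurable_cst.
  by apply/funext => t; rewrite nth_default ?size_tuple.
rewrite (_ : (fun _ => _) = (fun t => tnth t (Ordinal ni))).
  exact: measurable_tnth.
by apply/funext => t; rewrite (tnth_nth 0).
Qed.

Section adaptive.
Context {R : realType} {dU : measure_display} {U : measurableType dU}.
Variables (k : nat) (A : {mfun (U * random_string)%type >-> R}).
Variable q : forall i : nat, R.-pker (i.-tuple R) ~> U.

Local Notation seed := (random_string * k.-tuple R)%type.

Definition next_query i (z : seed * i.-tuple R) : {measure set U -> \bar R} :=
  q i z.2.

Let measurable_next_query i V : measurable V ->
  measurable_fun [set: (seed * i.-tuple R)%type] (@next_query i ^~ V).
Proof.
move=> mV; rewrite /next_query.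
exact: (measurableT_comp (measurable_kernel (q i) _ mV) measurable_snd).
Qed.

HB.instance Definition _ i :=
  isKernel.Build _ _ _ _ R (@next_query i) (@measurable_next_query i).

Let next_query_prob i z : @next_query i z [set: U] = 1%E.
Proof. exact: prob_kernel. Qed.

HB.instance Definition _ i :=
  Kernel_isProbability.Build _ _ _ _ R (@next_query i) (@next_query_prob i).

(* Here p = (((r, y), h), x): the noisy answer A_r(x) + y_i to the query x is
   appended to the history h = (a_0, ..., a_(i-1)). *)
Definition append_answer i (p : (seed * i.-tuple R) * U) : i.+1.-tuple R :=
  [tuple of rcons p.1.2 (A (p.2, p.1.1.1) + p.1.1.2`_i)].

Lemma measurable_append_answer i : measurable_fun setT (@append_answer i).
Proof.
have m11 : measurable_fun [set: ((seed * i.-tuple R) * U)%type]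
    (fun p => p.1.1) by exact: measurableT_comp.
apply/measurable_fun_tnthP => j.
have -> : tnth (T:=R) ^~ j \o @append_answer i = fun p =>
    if (j < i)%N then p.1.2`_j else A (p.2, p.1.1.1) + p.1.1.2`_i.
  apply/funext => p /=; rewrite (tnth_nth 0) /= nth_rcons size_tuple.
  case: ltnP => // ij; rewrite ifT//.
  by rewrite eqn_leq ij andbT -ltnS ltn_ord.
case: (j < i)%N.
  apply: (measurableT_comp (@measurable_tuple_nth R i j)).
  exact: (measurableT_comp measurable_snd).
apply: measurable_funD.
  apply: (measurableT_comp (measurable_funPT A)).
  apply: measurable_fun_pair => //.
  exact: (measurableT_comp measurable_fst m11).
apply: (measurableT_comp (@measurable_tuple_nth R k i)).
exact: (measurableT_comp measurable_snd m11).
Qed.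

(* Conditional law of the first i answers given the random string r and the
   noise y: x_i is drawn from q i applied to the i previous answers,
   independently of everything else. *)
Fixpoint answers i : R.-pker seed ~> i.-tuple R :=
  match i return R.-pker seed ~> i.-tuple R with
  | 0 => kdirac (@measurable_cst _ _ seed (0.-tuple R) setT [tuple])
  | i'.+1 => pkcomp (answers i')
      (pkcomp (@next_query i') (kdirac (@measurable_append_answer i')))
  end.

(* Law of the k released answers when r ~ mu and y ~ N^k are drawn
   independently. *)
Definition adaptive_release (mu : probability random_string R)
    (N : probability R R) : probability (k.-tuple R) R :=
  kmix (mu \x iid N k)%E (answers k).

End adaptive.

Section privacy.
Local Open Scope ereal_scope.
Context {R : realType} {Data : Type}.
Variable nbr : Data -> Data -> Prop.

Definition global_sensitivity (f : Data -> R) : \bar R :=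
  ereal_sup [set s | exists D D', nbr D D' /\ s = `|f D - f D'|%:E].

(* The bounds on P[M(D) in V] / P[M(D') in V] are multiplied out, so that they
   also make sense when the denominator vanishes. *)
Definition differentially_private {d} {S : measurableType d} (eps : R)
    (M : Data -> probability S R) :=
  forall V : set S, measurable V -> forall D D' : Data, nbr D D' ->
    (expR (- eps))%:E * M D' V <= M D V /\
    M D V <= (expR eps)%:E * M D' V.

End privacy.

(* When no s > 0 qualifies the value is +oo; it is 0 exactly when X = 0 almost
   surely.  Restricting to s > 0 matters because t / 0 = 0 here. *)
Definition subexp_diameter {d} {T : measurableType d} {R : realType}
    (P : probability T R) (X : T -> R) : \bar R :=
  ereal_inf [set s%:E | s in [set s : R | 0 < s /\
    forall t : R, 0 < t ->
      (P [set w | (t <= `|X w|)%R] <= (2 * expR (- (t / s)))%:E)%E]].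

(* Main.v *)
(* Given the random string r, releasing A_r(x) + Y with Y Laplace has density
   exp((|a| - |a - A_r(x)|) / b) with respect to Laplace noise a.  Since every
   query depends only on the previous answers, the adaptive choice of queries
   does not depend on r once the answers are fixed, and the whole release has
   density E_r[exp(sum_i (|a_i| - |a_i - A_r(x_i)|) / b)] with respect to the
   law of the queries with pure noise as answers.  It is therefore enough to
   compare these expectations for two neighbors D and D' at fixed queries and
   answers.

   Put Z_i = A_r(D, x_i) - g(D, x_i), l = k / b and s = l * Delta2.  Replacing A
   by g costs a factor at most E[exp((l / k) sum |Z_i|)], bounded through
   convexity by max_i E[exp(l |Z_i|)] <= 2^s / (1 - s); for D' one needs
   E[exp(-(l / k) sum |Z_i|)] >= exp(-(l / k) sum E|Z_i|) >= exp(-s (1 + ln 2)).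
   As 1 / (1 - s) <= 4^s for s <= 1/2, the total loss is at most
   exp(l (Delta1 + (1 + 4 ln 2) Delta2)).  This already gives the constant
   c = 1 + 4 ln 2 for every k and every epsilon <= c / 2. *)

Require Import Defs.
From HB Require Import structures.
From mathcomp Require Import all_boot all_order all_algebra.
From mathcomp Require Import all_classical all_reals all_analysis.
From mathcomp Require Import measurable_realfun ring lra.

Set Implicit Arguments.
Unset Strict Implicit.
Unset Printing Implicit Defensive.

Import Order.TTheory GRing.Theory Num.Theory.
Import numFieldNormedType.Exports.

Local Open Scope classical_set_scope.
Local Open Scope ring_scope.

(** * Exponential tails *)

Lemma integral_prob_cst d (T : measurableType d) (R : realType)
    (P : probability T R) (c : \bar R) : (\int[P]_w c = c)%E.
Proof.
by rewrite integral_cst// -[RHS]mule1; congr (_ * _)%E; exact: probability_setT.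
Qed.

(** Layer-cake formula: the expectation of a nonnegative variable is the integral of its tail, so a
    bound [h] on the tail integrates to a bound on the mean. *)
Lemma le_expectation_ccdf d (T : measurableType d) (R : realType)
    (P : probability T R) (X : T -> R) (h : R -> R) :
  measurable_fun setT X -> (forall w, 0 <= X w) ->
  measurable_fun setT h ->
  (forall t, 0 < t -> (P [set w | (t < X w)%R] <= (h t)%:E)%E) ->
  (\int[P]_w (X w)%:E <= \int[lebesgue_measure]_(t in `]0%R, +oo[) (h t)%:E)%E.
Proof.
move=> mX X0 mh Ph.
pose Y : {RV P >-> R} := HB.pack X (isMeasurableFun.Build _ _ _ _ X mX).
have := @ge0_expectation_ccdf _ _ _ P Y X0.
rewrite unlock => ->.
rewrite -integral_itv_obnd_cbnd//; last first.
  apply: measurable_funTS; exact: ccdf_measurable.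
apply: ge0_le_integral => //.
- apply: measurable_funTS; exact: ccdf_measurable.
- by apply/measurable_funTS/measurable_EFinP.
- move=> t /=; rewrite in_itv/= andbT => t0.
  rewrite /ccdf /distribution/= /pushforward.
  rewrite [X in P X](_ : _ = [set w | (t < X w)%R]); first exact: Ph.
  by apply/seteqP; split => w /=; rewrite in_itv/= andbT.
Qed.

Lemma integral_expRN (R : realType) :
  (\int[lebesgue_measure]_(t in `]0%R, +oo[) (expR (- t : R))%:E = 1)%E.
Proof.
rewrite integral_itv_obnd_cbnd; last first.
  by apply/measurable_EFinP; apply: measurable_funTS; apply: measurableT_comp.
rewrite (@ge0_continuous_FTC2y _ _ (fun x => - expR (- x)) _ 0)//.
- by rewrite oppr0 expR0 -EFinB opprK add0r.
- by apply: continuous_subspaceT => x; apply: continuous_comp;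
    [exact: opp_continuous|exact: continuous_expR].
- rewrite -oppr0; apply: cvgN. exact: cvgr_expR.
- apply/cvg_at_right_filter; apply: cvgN.
  by apply: (@continuous_comp _ _ _ (@GRing.opp R) expR);
    [exact: opp_continuous|exact: continuous_expR].
- move=> x _; rewrite derive1E.
  suff : is_derive x 1 (fun x =>
    - expR (- x)) (expR (- x)) by move=> /@derive_val.
  have d1 : is_derive x 1 (fun x : R => - x) (-1) by apply: is_derive_eq.
  have := @is_derive1_comp _ (@expR R) (fun x =>
    - x) x _ _ (is_derive_expR _) d1.
  by move=> /is_deriveN; rewrite mulrN1 opprK.
Qed.

(** The integrand is [(1 + t)^(-1/th)], the tail of [expR (th * X) - 1] for a standard exponential
    [X]. As [1/th > 1], it has an antiderivative, [F] below, that vanishes at infinity. *)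
Lemma integral_expRN_ln1D (R : realType) (th : R) : 0 < th -> th < 1 ->
  (\int[lebesgue_measure]_(t in `]0%R, +oo[) (expR (- (ln (1 + t) / th)))%:E
   = (th / (1 - th))%:E)%E.
Proof.
move=> th0 th1.
have a0 : 0 < th^-1 - 1 by rewrite subr_gt0 invf_gt1.
pose F (t : R) := - (th / (1 - th)) * expR (- (ln (1 + t) * (th^-1 - 1))).
have dF (t : R) : 0 <= t ->
    is_derive t 1 F (expR (- (ln (1 + t) / th))).
  move=> t0; have t1 : 0 < 1 + t by rewrite ltr_wpDr.
  have dln : is_derive t 1 (fun t => ln (1 + t)) (1 + t)^-1.
    have h : is_derive t 1 (fun t : R => 1 + t) 1.
      rewrite -[X in is_derive _ _ _ X]add0r.
      exact: is_deriveD.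
    rewrite -[X in is_derive _ _ _ X]mulr1.
    exact: (@is_derive1_comp _ (@ln R) (fun t => 1 + t) t _ 1
      (is_derive1_ln t1) h).
  have d1 : is_derive t 1 (fun t => - (ln (1 + t) * (th^-1 - 1)))
      (- ((1 + t)^-1 * (th^-1 - 1))).
    apply: is_deriveN; rewrite mulrC.
    under eq_fun do rewrite mulrC.
    exact: is_deriveZ.
  have d2 := @is_derive1_comp _ (@expR R)
    (fun t => - (ln (1 + t) * (th^-1 - 1))) t _ _ (is_derive_expR _) d1.
  rewrite (_ : expR _ = - (th / (1 - th)) *
    (expR (- (ln (1 + t) * (th^-1 - 1))) * - ((1 + t)^-1 * (th^-1 - 1)))).
    exact: is_deriveZ.
  rewrite mulrBr opprB mulr1 expRD lnK ?posrE//.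
  have h1 : 1 - th != 0 by rewrite lt0r_neq0// subr_gt0.
  have h2 := lt0r_neq0 th0; have h3 := lt0r_neq0 t1.
  by field; rewrite h1 h2 h3.
have cf (t : R) : 0 <= t -> {for t, continuous (fun t : R =>
  expR (- (ln (1 + t) / th)))}.
  move=> t0; have t1 : 0 < 1 + t by rewrite ltr_wpDr.
  apply: continuous_comp; last exact: continuous_expR.
  apply: continuousN; apply: continuousM; last exact: cst_continuous.
  apply: continuous_comp; last exact: continuous_ln.
  by apply: continuousD => //; exact: cst_continuous.
rewrite integral_itv_obnd_cbnd; last first.
  apply/measurable_EFinP/measurable_funTS.
  apply: (measurableT_comp (@measurable_expR R)); apply: measurable_funN.
  apply: measurable_funM => //; apply: (measurableT_comp (@measurable_ln R)).
  exact: measurable_funD.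
rewrite (@ge0_continuous_FTC2y _ _ F _ 0).
- rewrite /F addr0 ln1 mul0r oppr0 expR0 mulr1 -EFinB sub0r opprK//.
- by move=> x _; exact: expR_ge0.
- apply/continuous_within_itvcyP; split; last exact/cvg_at_right_filter/cf.
  by move=> x; rewrite in_itv/= andbT => /ltW/cf.
- rewrite -[X in _ --> X](mulr0 (- (th / (1 - th)))); apply: cvgMr.
  apply: (@cvg_comp _ _ _ (fun t => ln (1 + t) * (th^-1 - 1)) (fun x =>
    expR (- x)));
    last exact: cvgr_expR.
  apply/cvgryPge => A; near=> t.
  have t0 : 0 <= t by near: t; exact: nbhs_pinfty_ge.
  rewrite -ler_pdivrMr// -ler_expR lnK ?posrE ?ltr_wpDr//.
  by rewrite (@le_trans _ _ t) ?lerDr//; near: t; apply: nbhs_pinfty_ge;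
    rewrite num_real.
- by move=> x /ltW /dF /@ex_derive.
- apply/cvg_at_right_filter/differentiable_continuous/derivable1_diffP.
  by have /@ex_derive := dF 0 (lexx 0).
- by move=> x; rewrite in_itv/= andbT => /ltW /dF;
    rewrite derive1E => /@derive_val.
Unshelve. all: end_near. Qed.

(** The tail of [X] is dominated by that of a standard exponential variable, whose moment generating
    function at [th] is [1 / (1 - th)]. The layer-cake bound is applied to [expR (th * X) - 1], so
    that a level [t > 0] corresponds to the level [ln (1 + t) / th > 0] of [X], where the hypothesis
    applies. *)
Lemma integral_exp_tail d (T : measurableType d) (R : realType)
    (P : probability T R) (X : T -> R) (th : R) :
  measurable_fun setT X -> (forall w, 0 <= X w) ->
  (forall v, 0 < v -> (P [set w | (v <= X w)%R] <= (expR (- v))%:E)%E) ->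
  0 < th -> th < 1 ->
  (\int[P]_w (expR (th * X w))%:E <= (1 - th)^-1%:E)%E.
Proof.
move=> mX X0 PX th0 th1.
have mE : measurable_fun setT (fun w => expR (th * X w)).
  by apply: measurableT_comp => //; exact: measurable_funM.
have E1 w : 1 <= expR (th * X w).
  by rewrite -expR0 ler_expR mulr_ge0// ltW.
have := @le_expectation_ccdf _ _ _ P (fun w => expR (th * X w) - 1)
  (fun t => expR (- (ln (1 + t) / th))).
rewrite integral_expRN_ln1D//.
have -> : (\int[P]_w (expR (th * X w))%:E =
   1 + \int[P]_w (expR (th * X w) - 1)%:E)%E.
  rewrite -(@probability_setT _ _ _ P) -[P setT]mul1e -integral_cst//.
  rewrite -ge0_integralD//.
  - by apply: eq_integral => w _ /=; rewrite -EFinD addrC subrK.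
  - by move=> w _; rewrite lee_fin subr_ge0.
  - by apply/measurable_EFinP/measurable_funB.
move=> H; apply: (@le_trans _ _ (1 + (th / (1 - th))%:E)%E).
  rewrite leeD2l//; apply: H.
  - exact: measurable_funB.
  - by move=> w; rewrite subr_ge0.
  - apply: (measurableT_comp (@measurable_expR R)); apply: measurable_funN.
    apply: measurable_funM => //; apply: (measurableT_comp (@measurable_ln R)).
    exact: measurable_funD.
  - move=> t t0; have l0 : 0 < ln (1 + t) / th.
      by rewrite divr_gt0// ln_gt0// ltrDl.
    apply: le_trans (PX _ l0); apply: le_measure; rewrite ?inE//=.
    + by rewrite -[X in measurable X]setTI; apply: measurable_fun_ltr => //;
        exact: measurable_funB.
    + by rewrite -[X in measurable X]setTI; apply: measurable_fun_le.
    + move=> w /=; rewrite ltrBrDl => /ltW tw.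
      by rewrite ler_pdivrMr// mulrC -ler_expR lnK// posrE ltr_wpDr// ltW.
rewrite -EFinD lee_fin.
have : 1 - th != 0 by rewrite lt0r_neq0// subr_gt0.
move=> ?; rewrite le_eqVlt; apply/orP; left; by apply/eqP; field.
Qed.

Lemma expectation_exp_tail d (T : measurableType d) (R : realType)
    (P : probability T R) (X : T -> R) :
  measurable_fun setT X -> (forall w, 0 <= X w) ->
  (forall v, 0 < v -> (P [set w | (v <= X w)%R] <= (expR (- v))%:E)%E) ->
  (\int[P]_w (X w)%:E <= 1)%E.
Proof.
move=> mX X0 PX; rewrite -(integral_expRN R).
apply: le_expectation_ccdf => //.
  by apply: (measurableT_comp (@measurable_expR R)); apply: measurable_funN.
move=> t t0; apply: le_trans (PX _ t0); apply: le_measure; rewrite ?inE//=.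
- by rewrite -[X in measurable X]setTI; apply: measurable_fun_ltr.
- by rewrite -[X in measurable X]setTI; apply: measurable_fun_le.
- by move=> w /= /ltW.
Qed.

Section subexponential.
Context d (T : measurableType d) (R : realType) (P : probability T R).

Definition subexp_tail (s : R) (Z : T -> R) :=
  forall t, 0 < t ->
    (P [set w | (t <= `|Z w|)%R] <= (2 * expR (- (t / s)))%:E)%E.

Variables (s : R) (Z : T -> R).
Hypotheses (s0 : 0 < s) (mZ : measurable_fun setT Z) (tZ : subexp_tail s Z).

(* The factor 2 of the tail bound is a shift by [ln 2]: [X] has tail at most
   [expR (- v)]. *)
Let X w := Num.max (`|Z w| / s - ln 2) 0.

Let mX : measurable_fun setT X.
Proof.
apply: measurable_maxr => //; apply: measurable_funB => //.
by apply: measurable_funM => //;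
  exact: (measurableT_comp (@normr_measurable R setT)).
Qed.

Let X0 w : 0 <= X w. Proof. by rewrite le_max lexx orbT. Qed.

Let tailX v : 0 < v -> (P [set w | (v <= X w)%R] <= (expR (- v))%:E)%E.
Proof.
move=> v0; have l0 : 0 <= ln 2 :> R by rewrite ln_ge0// ler1n.
rewrite (_ : [set w | _] = [set w | s * (v + ln 2) <= `|Z w|]); last first.
  apply/seteqP; split => w /=; rewrite le_max (leNgt v 0) v0 orbF;
    by rewrite lerBrDr ler_pdivlMr// mulrC.
apply: le_trans (tZ _) _; first by rewrite mulr_gt0// ltr_wpDr.
rewrite lee_fin mulrAC divff ?lt0r_neq0// mul1r opprD expRD (expRN (ln 2)).
by rewrite (@lnK R 2) ?posrE// mulrCA divff// mulr1.
Qed.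

Let ZX w : `|Z w| <= s * (X w + ln 2).
Proof. by rewrite mulrC -ler_pdivrMr// -lerBlDr le_max lexx. Qed.

(** By [ZX], the exponent is at most [l * s * X + l * s * ln 2]: the shift contributes the factor
    [2^(l * s)], and the exponential tail of [X] contributes [1 / (1 - l * s)]. *)
Lemma subexp_tail_mgf (l : R) : 0 < l -> l * s < 1 ->
  (\int[P]_w (expR (l * `|Z w|))%:E <=
    (expR (l * s * ln 2) / (1 - l * s))%:E)%E.
Proof.
move=> l0 ls1.
apply: (@le_trans _ _
  (\int[P]_w ((expR (l * s * ln 2))%:E * (expR (l * s * X w))%:E))%E).
  apply: ge0_le_integral => //.
  - apply/measurable_EFinP; apply: (measurableT_comp (@measurable_expR R)).
    by apply: measurable_funM => //;
      exact: (measurableT_comp (@normr_measurable R setT)).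
  - apply/measurable_EFinP; apply: measurable_funM => //;
      apply: (measurableT_comp (@measurable_expR R)).
    exact: measurable_funM.
  - move=> w _; rewrite -EFinM lee_fin -expRD ler_expR -mulrDr -mulrA addrC.
    by rewrite ler_pM2l.
rewrite ge0_integralZl//.
- rewrite EFinM lee_pmul2l//; last by rewrite lte_fin expR_gt0.
  by apply: integral_exp_tail => //; rewrite mulr_gt0.
- apply/measurable_EFinP; apply: (measurableT_comp (@measurable_expR R)).
  exact: measurable_funM.
Qed.

Lemma subexp_tail_mean : (\int[P]_w `|Z w|%:E <= (s * (1 + ln 2))%:E)%E.
Proof.
have l0 : 0 <= ln 2 :> R by rewrite ln_ge0// ler1n.
apply: (@le_trans _ _ (\int[P]_w (s%:E * (X w)%:E + (s * ln 2)%:E))%E).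
  apply: ge0_le_integral => //.
  - by apply/measurable_EFinP;
      exact: (measurableT_comp (@normr_measurable R setT)).
  - by apply: emeasurable_funD => //; apply/measurable_EFinP;
      exact: measurable_funM.
  - by move=> w _; rewrite -EFinM -EFinD lee_fin -mulrDr.
rewrite ge0_integralD//.
- rewrite (@ge0_integralZl _ _ _ P setT _ (EFin \o X))//.
  + rewrite integral_prob_cst mulrDr mulr1 EFinD leeD2r//.
    rewrite -[leRHS]mule1 lee_pmul2l//.
    exact: expectation_exp_tail.
  + exact/measurable_EFinP.
  + by move=> w _; rewrite lee_fin.
  + by rewrite lee_fin ltW.
- by move=> w _; rewrite -EFinM lee_fin mulr_ge0// ltW.
- by apply/measurable_EFinP; exact: measurable_funM.
- by move=> w _; rewrite lee_fin mulr_ge0// ltW.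
Qed.

End subexponential.

(** * Exponential averages of errors and comparison of weights *)

Lemma expR_mean (R : realType) (J : Type) (L : seq J) (w : J -> R) :
  (0 < size L)%N ->
  expR ((size L)%:R^-1 * \sum_(j <- L) w j) <=
  (size L)%:R^-1 * \sum_(j <- L) expR (w j).
Proof.
move=> L0; set m := _ * \sum_(j <- L) _.
have k0 : 0 < (size L)%:R :> R by rewrite ltr0n.
rewrite -(ler_pM2l k0) mulrA divff ?lt0r_neq0// mul1r.
(* tangent line of exp at the mean *)
have -> : (size L)%:R * expR m = \sum_(j <- L) (expR m * (1 + (w j - m))).
  rewrite -mulr_sumr big_split /= sumrB !big_const_seq !count_predT
    !iter_addr_0.
  by rewrite -(mulr_natl m) /m mulrA divff ?lt0r_neq0// mul1r subrr addr0 mulrC.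
apply: ler_sum => j _; rewrite -[w j in leRHS](subrK m) expRD mulrC.
by rewrite ler_pM2r ?expR_gt0// expR_ge1Dx.
Qed.

Section weights.
Context d (T : measurableType d) (R : realType) (P : probability T R).
Variables (J : Type) (s l : R).
Hypotheses (s0 : 0 < s) (l0 : 0 < l) (ls : l * s < 1).

Section averages.
Variables (L : seq J) (Z : J -> T -> R).
Hypotheses (mZ : forall j, measurable_fun setT (Z j))
  (tZ : forall j, subexp_tail P s (Z j)) (L0 : (0 < size L)%N).
Local Notation k := (size L)%:R.

Let k0 : 0 < k^-1 :> R. Proof. by rewrite invr_gt0 ltr0n. Qed.

Let mnZ j : measurable_fun setT (fun w => `|Z j w|).
Proof. exact: (measurableT_comp (@normr_measurable R setT)). Qed.

(** The [Z j] are functions of the same [w] and need not be independent. Convexity of exp bounds the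
    exponential of the average by the average of the exponentials, so only the marginal tails enter
    and the bound does not grow with the length of [L]. *)
Lemma mean_mgf_le :
  (\int[P]_w (expR (k^-1 * \sum_(j <- L) l * `|Z j w|))%:E
    <= (expR (l * s * ln 2) / (1 - l * s))%:E)%E.
Proof.
have mE j : measurable_fun setT (fun w => (expR (l * `|Z j w|))%:E).
  apply/measurable_EFinP; apply: (measurableT_comp (@measurable_expR R)).
  exact: measurable_funM.
apply: (@le_trans _ _ (\int[P]_w (k^-1%:E * \sum_(j <- L) (expR (l * `|Z j
  w|))%:E))%E).
  apply: ge0_le_integral => //.
  - apply/measurable_EFinP; apply: (measurableT_comp (@measurable_expR R)).
    apply: measurable_funM => //; apply: measurable_sum => j.
    exact: measurable_funM.
  - apply: measurable_funeM; exact: emeasurable_sum.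
  - by move=> w _; rewrite sumEFin -EFinM lee_fin expR_mean.
rewrite ge0_integralZl//; first last.
- by move=> w _; apply: sume_ge0 => j _; rewrite lee_fin expR_ge0.
- exact: emeasurable_sum.
rewrite ge0_integral_sum//.
rewrite lee_pdivrMl ?ltr0n//.
apply: (@le_trans _ _ (\sum_(j <- L) (expR (l * s * ln 2) / (1 - l * s))%:E)%E).
  by apply: lee_sum => j _; exact: subexp_tail_mgf.
rewrite sumEFin -EFinM lee_fin big_const_seq count_predT iter_addr_0.
by rewrite mulr_natl.
Qed.

(** Jensen's inequality in the opposite direction, through the tangent line of exp at [-m], where
    [m] bounds the mean of the average [S]. The term linear in [S] is kept on the side of the larger
    quantity, so that all integrands stay nonnegative. *)
Lemma mean_expRN_ge :
  ((expR (- (l * (s * (1 + ln 2)))))%:E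
    <= \int[P]_w (expR (- (k^-1 * \sum_(j <- L) l * `|Z j w|)))%:E)%E.
Proof.
set m := l * _; pose S w := k^-1 * \sum_(j <- L) l * `|Z j w|.
have S0 w : 0 <= S w.
  apply: mulr_ge0; first exact: ltW.
  by apply: sumr_ge0 => j _; rewrite mulr_ge0// ltW.
have mS : measurable_fun setT S.
  apply: measurable_funM => //; apply: measurable_sum => j.
  exact: measurable_funM.
have mES : measurable_fun setT (fun w => expR (- S w)).
  by apply: (measurableT_comp (@measurable_expR R)); exact: measurable_funN.
have ES : (\int[P]_w (S w)%:E <= m%:E)%E.
  under eq_integral do rewrite /S EFinM -sumEFin.
  have mlZ j : measurable_fun setT (fun w => (l * `|Z j w|)%:E).
    by apply/measurable_EFinP; exact: measurable_funM.
  have lZ0 j w : (0 <= (l * `|Z j w|)%:E)%E by rewrite lee_fin mulr_ge0// ltW.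
  rewrite ge0_integralZl//; first last.
  - by move=> w _; apply: sume_ge0.
  - exact: emeasurable_sum.
  rewrite ge0_integral_sum// lee_pdivrMl ?ltr0n//.
  apply: (@le_trans _ _ (\sum_(j <- L) m%:E)%E).
    apply: lee_sum => j _; under eq_integral do rewrite EFinM.
    rewrite (@ge0_integralZl _ _ _ P setT _ (fun w => `|Z j w|%:E))//;
      first last.
    - by rewrite lee_fin ltW.
    - exact/measurable_EFinP.
    by rewrite /m EFinM lee_pmul2l// subexp_tail_mean.
  rewrite sumEFin -EFinM lee_fin big_const_seq count_predT iter_addr_0.
  by rewrite mulr_natl.
(* tangent line of exp at -m *)
have H : ((expR (- m))%:E * (1 + m%:E) <=
    \int[P]_w (expR (- S w))%:E + (expR (- m))%:E * \int[P]_w (S w)%:E)%E.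
  have m0 : 0 <= m by rewrite !mulr_ge0 ?ltW// ltr_wpDr// ln_ge0// ler1n.
  rewrite -(@ge0_integralZl _ _ _ P setT _ (EFin \o S))//; first last.
  - by move=> w _; rewrite lee_fin.
  - exact/measurable_EFinP.
  rewrite -ge0_integralD//; first last.
  - by apply/measurable_EFinP; exact: measurable_funM.
  - by move=> w _; rewrite -EFinM lee_fin mulr_ge0.
  - exact/measurable_EFinP.
  rewrite -EFinD -EFinM -[X in (X <= _)%E](integral_prob_cst P).
  apply: ge0_le_integral => //.
  - by move=> w _; rewrite lee_fin mulr_ge0// addr_ge0.
  - apply/measurable_EFinP; apply: measurable_funD => //;
      exact: measurable_funM.
  move=> w _; rewrite -EFinM -EFinD lee_fin -lerBlDr -mulrBr.
  rewrite -[in leRHS](addKr m (- S w)) expRD ler_pM2l ?expR_gt0//.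
  by rewrite -addrA expR_ge1Dx.
rewrite -(@leeD2rE _ (expR (- m) * m)%:E)// -EFinD.
apply: le_trans (le_trans _ H) _.
  by rewrite -EFinD -EFinM lee_fin mulrDr mulr1.
rewrite leeD2l// EFinM.
by rewrite lee_pmul2l// lte_fin expR_gt0.
Qed.

End averages.

(** On [[- ln 2, 0]] the convex function exp lies below its chord, which joins the values [1/2] and
    [1]; the point [- (2 * ln 2 * x)] has barycentric weight [2 * x] at the left end. *)
Lemma expRN_ln2_le (x : R) : 0 <= x -> x <= 2^-1 ->
  expR (- (2 * ln 2 * x)) <= 1 - x.
Proof.
move=> x0 x1.
have t01 : 0 <= 2 * x <= 1 by rewrite mulr_ge0//= -ler_pdivlMl// mulr1.
pose t : {i01 R} := Itv01 (proj1 (andP t01)) (proj2 (andP t01)).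
have := convex_expR t (- ln 2) 0.
rewrite !convRE expR0 expRN (@lnK R 2) ?posrE//= mulr0 addr0 mulr1.
rewrite (_ : - (2 * ln 2 * x) = 2 * x * - ln 2); last by ring.
by rewrite /unstable.onem => /le_trans; apply; lra.
Qed.

Lemma weight_le (L : seq J) (f f' : J -> T -> R) (g g' a : J -> R)
    (D1 e b : R) :
  (0 < size L)%N ->
  (forall j, measurable_fun setT (f j)) ->
  (forall j, measurable_fun setT (f' j)) ->
  (forall j, subexp_tail P s (fun w => f j w - g j)) ->
  (forall j, subexp_tail P s (fun w => f' j w - g' j)) ->
  (forall j, `|g j - g' j| <= D1) ->
  l = (size L)%:R / b -> l * s <= 2^-1 -> l * (D1 + s * (1 + 4 * ln 2)) <= e ->
  (\int[P]_w (expR (\sum_(j <- L) (`|a j| - `|a j - f j w|) / b))%:E <=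
   (expR e)%:E *
   \int[P]_w (expR (\sum_(j <- L) (`|a j| - `|a j - f' j w|) / b))%:E)%E.
Proof.
move=> L0 mf mf' tf tf' gg' lE ls2 le.
have k0 : 0 < (size L)%:R :> R by rewrite ltr0n.
(* Writing [1 / b] as [l] over the number of answers turns sums scaled by [1 / b] into averages
   scaled by [l]. *)
have lb : b^-1 = (size L)%:R^-1 * l by rewrite lE mulKf// lt0r_neq0.
have bV0 : 0 < b^-1 by rewrite lb// mulr_gt0// invr_gt0.
pose Z j w := f j w - g j; pose Z' j w := f' j w - g' j.
pose G (h : J -> R) := \sum_(j <- L) (`|a j| - `|a j - h j|) / b.
have mZ j : measurable_fun setT (Z j) by exact: measurable_funB.
have mZ' j : measurable_fun setT (Z' j) by exact: measurable_funB.
have mabs (F : J -> T -> R) : (forall j, measurable_fun setT (F j)) ->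
    forall j, measurable_fun setT (fun w => `|F j w|).
  by move=> mF j; exact: (measurableT_comp (@normr_measurable R setT)).
have mw (F : J -> T -> R) : (forall j, measurable_fun setT (F j)) ->
  measurable_fun setT
    (fun w => (expR (\sum_(j <- L) (`|a j| - `|a j - F j w|) / b))%:E).
  move=> mF; apply/measurable_EFinP;
    apply: (measurableT_comp (@measurable_expR R)).
  apply: measurable_sum => j; apply: measurable_funM => //.
  apply: measurable_funB => //; apply: (mabs (fun j w => a j - F j w)) => i.
  exact: measurable_funB.
have meanE (F : J -> T -> R) w : (size L)%:R^-1 * \sum_(j <- L) l * `|F j w| =
    \sum_(j <- L) `|F j w : R| / b.
  rewrite mulr_sumr; apply: eq_bigr => j _.
  by rewrite mulrA -lb// mulrC.
(* By the triangle inequality, replacing [f j w] by [g j] changes each term of the exponent by at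
   most [|Z j w| / b]. *)
have ub : (\int[P]_w (expR (\sum_(j <- L) (`|a j| - `|a j - f j w|) / b))%:E <=
    (expR (G g))%:E * (expR (l * s * ln 2) / (1 - l * s))%:E)%E.
  apply: (@le_trans _ _ (\int[P]_w ((expR (G g))%:E *
      (expR ((size L)%:R^-1 * \sum_(j <- L) l * `|Z j w|))%:E))%E).
    apply: ge0_le_integral => //.
    + exact: mw.
    + apply/measurable_EFinP; apply: measurable_funM => //.
      apply: (measurableT_comp (@measurable_expR R));
        apply: measurable_funM => //.
      apply: measurable_sum => j; apply: measurable_funM => //; exact: mabs.
    + move=> w _; rewrite meanE -EFinM -expRD lee_fin ler_expR /G -big_split/=.
      apply: ler_sum => j _; rewrite -mulrDl ler_pM2r// -addrA lerD2l /Z.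
      have := ler_distD (f j w) (a j) (g j); lra.
  rewrite ge0_integralZl//; first last.
  - apply/measurable_EFinP; apply: (measurableT_comp (@measurable_expR R)).
    apply: measurable_funM => //; apply: measurable_sum => j;
      apply: measurable_funM => //; exact: mabs.
  by rewrite lee_pmul2l ?lte_fin ?expR_gt0//; exact: mean_mgf_le.
(* The same replacement for the other dataset, now read as a lower bound. *)
have lb' : ((expR (G g'))%:E * (expR (- (l * (s * (1 + ln 2)))))%:E <=
    \int[P]_w (expR (\sum_(j <- L) (`|a j| - `|a j - f' j w|) / b))%:E)%E.
  have mS : measurable_fun setT (fun w =>
      (expR (- ((size L)%:R^-1 * \sum_(j <- L) l * `|Z' j w|)))%:E).
    apply/measurable_EFinP; apply: (measurableT_comp (@measurable_expR R)).
    apply: measurable_funN; apply: measurable_funM => //.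
    apply: measurable_sum => j; apply: measurable_funM => //; exact: mabs.
  apply: (@le_trans _ _ (\int[P]_w ((expR (G g'))%:E *
      (expR (- ((size L)%:R^-1 * \sum_(j <- L) l * `|Z' j w|)))%:E))%E).
    rewrite ge0_integralZl//.
    by rewrite lee_pmul2l ?lte_fin ?expR_gt0//; exact: mean_expRN_ge.
  apply: ge0_le_integral => //.
  + exact: measurable_funeM.
  + exact: mw.
  + move=> w _; rewrite meanE -EFinM -expRD lee_fin ler_expR /G -sumrN
      -big_split/=.
    apply: ler_sum => j _; rewrite -mulNr -mulrDl ler_pM2r// -addrA lerD2l /Z'.
    have := ler_distD (g' j) (a j) (f' j w); rewrite (distrC (g' j)); lra.
apply: le_trans ub (le_trans _ (lee_wpmul2l _ lb')) => //.
rewrite -!EFinM lee_fin -!expRD.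
(* Each of the [size L] terms moves by at most [D1 / b], which adds up to [l * D1]. *)
have GG : G g <= G g' + l * D1.
  rewrite -lerBlDl /G -sumrB lE -mulrA mulr_natl.
  rewrite -(count_predT L) -[leRHS]addr0 -iter_addr -big_const_seq.
  apply: ler_sum => j _; rewrite -mulrBl mulrC ler_pM2l//.
  have := gg' j; have := ler_distD (g j) (a j) (g' j); lra.
rewrite [leLHS]mulrA -expRD ler_pdivrMr ?subr_gt0//.
(* The three losses in units of [l * s] are [ln 2] from the shift, [1 + ln 2] from the lower bound
   and [2 * ln 2] from [1 / (1 - l * s)]; they sum to [1 + 4 * ln 2]. *)
apply: (@le_trans _ _ (expR (e + (G g' - l * (s * (1 + ln 2)))) *
    expR (- (2 * ln 2 * (l * s))))).
  rewrite -expRD ler_expR.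
  move: le; rewrite !mulrDr mulr1; lra.
by rewrite ler_pM2l ?expR_gt0// expRN_ln2_le// mulr_ge0// ltW.
Qed.

End weights.

(** * Laplace noise *)

Import HBNNSimple.

(** By monotone convergence both sides are limits along simple approximations of [f]; on a level set
    of a simple function the identity is the hypothesis on [nu]. *)
Lemma ge0_integral_density d (T : measurableType d) (R : realType)
    (m nu : {measure set T -> \bar R}) (p : T -> R) (f : T -> \bar R) :
  (forall x, 0 <= p x) -> measurable_fun setT p ->
  (forall V, measurable V -> nu V = (\int[m]_(x in V) (p x)%:E)%E) ->
  (forall x, (0 <= f x)%E) -> measurable_fun setT f ->
  (\int[nu]_x f x = \int[m]_x (f x * (p x)%:E))%E.
Proof.
move=> p0 mp nuE f0 mf.
have mpE : measurable_fun setT (EFin \o p) by exact/measurable_EFinP.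
pose f_ := nnsfun_approx measurableT mf.
have fcvg (x : T) : (f_ n x)%:E @[n --> \oo] --> f x by exact:
  cvg_nnsfun_approx.
transitivity (limn (fun n => \int[nu]_x (f_ n x)%:E)%E).
  rewrite -monotone_convergence//.
  - by apply: eq_integral => x _; apply/esym/cvg_lim => //; exact: fcvg.
  - by move=> n; exact/measurable_EFinP.
  - by move=> n x _; rewrite lee_fin.
  - by move=> x _ a b ab; rewrite lee_fin; exact/lefP/nd_nnsfun_approx.
transitivity (limn (fun n => \int[m]_x ((f_ n x)%:E * (p x)%:E))%E); last first.
  rewrite -monotone_convergence//.
  - apply: eq_integral => x _; apply/cvg_lim => //.
    by apply: cvgeZr => //; exact: fcvg.
  - by move=> n; apply: emeasurable_funM => //; exact/measurable_EFinP.
  - by move=> n x _; rewrite mule_ge0// lee_fin.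
  - move=> x _ a b ab; rewrite lee_wpmul2r ?lee_fin//.
    exact/lefP/nd_nnsfun_approx.
apply: congr_lim; apply/funext => n.
under eq_integral do rewrite fimfunE -fsumEFin//.
rewrite ge0_integral_fsum//; last 2 first.
  - by move=> r; exact/measurable_EFinP/measurableT_comp.
  - by move=> r z _; rewrite EFinM nnfun_muleindic_ge0.
under [in RHS]eq_integral.
  move=> x _; rewrite fimfunE -fsumEFin// ge0_mule_fsuml.
    over.
  by move=> r; rewrite EFinM nnfun_muleindic_ge0.
rewrite /= ge0_integral_fsum//; last 2 first.
  - move=> r; apply: emeasurable_funM => //.
    by apply/measurable_EFinP/measurableT_comp.
  - move=> r z _; apply: mule_ge0; last by rewrite lee_fin.
    by rewrite EFinM nnfun_muleindic_ge0.
apply: eq_fsbigr => r _.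
have mr : measurable (f_ n @^-1` [set r]) by [].
have [r0|r0] := leP 0 r; last first.
  rewrite preimage_nnfun0//.
  by rewrite !integral0_eq// => x _; rewrite indic0 mulr0 ?mul0e.
under eq_integral do rewrite EFinM.
rewrite ge0_integralZl//; last exact/measurable_EFinP.
rewrite integral_indic// setIT nuE// integral_mkcond.
rewrite -ge0_integralZl//.
- apply: eq_integral => x _; rewrite patchE indicE EFinM -muleA;
    congr (_ * _)%E.
  by case: ifPn => _; rewrite ?mul1e ?mul0e.
- exact/(measurable_restrictT _ _).1/measurable_funTS.
- by move=> x _; rewrite erestrict_ge0// => y _; rewrite lee_fin.
Qed.

Section lebesgue_shift.
Context {R : realType}.
Local Notation leb := (@lebesgue_measure R).

Definition addl (c : R) : measurableTypeR R -> measurableTypeR R := +%R c.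

Lemma measurable_addl c : measurable_fun setT (addl c).
Proof. exact: measurable_funD. Qed.

HB.instance Definition _ c :=
  isMeasurableFun.Build _ _ _ _ (addl c) (measurable_addl c).

Lemma lebesgue_measure_addl (c : R) (A : set R) : measurable A ->
  pushforward leb (addl c) A = leb A.
Proof.
move=> mA; apply/esym/lebesgue_measure_unique => //= _ [[a b]] _ <-.
rewrite /pushforward /addl.
rewrite (_ : _ @^-1` _ = `](a - c), (b - c)]%classic); last first.
  by apply/seteqP; split => x /=; rewrite !in_itv/= ltrBlDl lerBrDl.
rewrite !lebesgue_measure_itv/= !lte_fin ltrD2r.
by case: ifP => // _; rewrite -!EFinB; congr EFin; ring.
Qed.

Lemma ge0_integral_addl (c : R) (f : R -> \bar R) :
  measurable_fun setT f -> (forall x, (0 <= f x)%E) ->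
  (\int[leb]_x f (c + x)%R = \int[leb]_x f x)%E.
Proof.
move=> mf f0.
transitivity (\int[pushforward leb (addl c)]_x f x)%E.
  by rewrite ge0_integral_pushforward//; exact: measurable_addl.
by apply: eq_measure_integral => A mA _; exact: lebesgue_measure_addl.
Qed.

(* Lebesgue measure lives on an alias of [R] with another display; this identity
   carries it over to [R], where [laplace] lives. *)
Definition of_measurableTypeR (x : measurableTypeR R) : R := x.

Lemma measurable_of_measurableTypeR : measurable_fun setT of_measurableTypeR.
Proof. by move=> _ A mA; rewrite setTI. Qed.

HB.instance Definition _ := isMeasurableFun.Build _ _ _ _
  of_measurableTypeR measurable_of_measurableTypeR.

Lemma ge0_integral_laplace (b : R) (f : R -> \bar R) : 0 < b ->
  measurable_fun setT f -> (forall x, (0 <= f x)%E) ->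
  (\int[laplace b]_y f y = \int[leb]_x (f x * (laplace_pdf b x)%:E))%E.
Proof.
move=> b0 mf f0; pose m := pushforward leb of_measurableTypeR.
have mp := measurable_laplace_pdf b.
have p0 x : 0 <= laplace_pdf b x by exact: laplace_pdf_ge0.
transitivity (\int[m]_x (f x * (laplace_pdf b x)%:E))%E; last first.
  rewrite ge0_integral_pushforward//.
  - by apply: emeasurable_funM => //; exact/measurable_EFinP.
  - by move=> x _; rewrite mule_ge0// lee_fin.
apply: ge0_integral_density => // V mV.
transitivity (laplace b V) => //.
rewrite /laplace b0 ge0_integral_pushforward//.
- exact/measurable_funTS/measurable_EFinP.
- by move=> x _; rewrite lee_fin.
Qed.

(** The exponential factor is the ratio of the Laplace densities at [y - c] and at [y]. Translating
    the right-hand Lebesgue integral by [c] makes the two integrands equal pointwise. *)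
Lemma integral_laplace_addl (b c : R) (f : R -> \bar R) : 0 < b ->
  measurable_fun setT f -> (forall x, (0 <= f x)%E) ->
  (\int[laplace b]_y f (c + y)%R =
   \int[laplace b]_y (f y * (expR ((`|y| - `|y - c|) / b))%:E))%E.
Proof.
move=> b0 mf f0.
have p0 x : 0 <= laplace_pdf b x by exact: laplace_pdf_ge0.
have msub (u : R) : measurable_fun setT (fun y : R => y - u).
  exact: measurable_funB.
have mnorm (u : R) : measurable_fun setT (fun y : R => `|y - u|).
  exact: (measurableT_comp (@normr_measurable R setT)).
have mp := measurable_laplace_pdf b.
rewrite ge0_integral_laplace//; last first.
  by apply: (measurableT_comp mf); exact: measurable_funD.
rewrite ge0_integral_laplace//; first last.
- by move=> x; rewrite mule_ge0// lee_fin expR_ge0.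
- apply: emeasurable_funM => //; apply/measurable_EFinP.
  apply: (measurableT_comp (@measurable_expR R)); apply: measurable_funM => //.
  by apply: measurable_funB => //; exact: normr_measurable.
rewrite -[RHS](ge0_integral_addl c).
- apply: eq_integral => x _; rewrite -muleA; congr (_ * _)%E.
  rewrite -EFinM /laplace_pdf; congr EFin.
  rewrite (addrC c) addrK mulrCA -expRD; congr (_ * expR _).
  by field; rewrite lt0r_neq0.
- apply: emeasurable_funM => //; last exact/measurable_EFinP.
  apply: emeasurable_funM => //; apply/measurable_EFinP.
  apply: (measurableT_comp (@measurable_expR R)); apply: measurable_funM => //.
  by apply: measurable_funB => //; exact: normr_measurable.
- by move=> x; rewrite !mule_ge0// lee_fin ?expR_ge0.
Qed.

End lebesgue_shift.

(** Coordinate [i] is independent of the coordinates before it, the only ones that [F] reads in its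
    first argument, so it may be replaced by a fresh draw from [P]. The induction peels off the
    first coordinate. *)
Lemma iid_integral_nth d (T : measurableType d) (R : realType)
    (P : probability T R) (x0 : T) n i (F : n.-tuple T -> T -> \bar R) :
  (i < n)%N -> measurable_fun setT (fun z : n.-tuple T * T => F z.1 z.2) ->
  (forall y t, (0 <= F y t)%E) ->
  (forall (y y' : n.-tuple T) t,
    (forall j, (j < i)%N -> nth x0 y j = nth x0 y' j) -> F y t = F y' t) ->
  (\int[iid P n]_y F y (nth x0 y i) = \int[iid P n]_y \int[P]_t F y t)%E.
Proof.
elim: n i F => [//|n IH] i F ni mF F0 Fdep.
have mFc : measurable_fun setT (fun z : (T * n.-tuple T) * T =>
  F (tuple_cons z.1) z.2).
  have h : measurable_fun setT
      (fun z : (T * n.-tuple T) * T => (tuple_cons z.1, z.2)).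
    apply: measurable_fun_pair => //.
    exact: (measurableT_comp (@measurable_tuple_cons _ T n)).
  exact: (measurableT_comp mF h).
have mnth m (k : nat) : measurable_fun setT (fun y : m.-tuple T => nth x0 y k).
  have [km|km] := ltnP k m.
    rewrite (_ : (fun _ => _) = (fun t => tnth t (Ordinal km))).
      exact: measurable_tnth.
    by apply/funext => t; rewrite (tnth_nth x0).
  rewrite (_ : (fun _ => _) = cst x0); first exact: measurable_cst.
  by apply/funext => t; rewrite nth_default ?size_tuple.
have mFn : measurable_fun setT (fun y : n.+1.-tuple T => F y (nth x0 y i)).
  have h : measurable_fun setT (fun y : n.+1.-tuple T => (y, nth x0 y i)).
    by apply: measurable_fun_pair => //; exact: mnth.
  exact: (measurableT_comp mF h).
have mFi : measurable_fun setT (fun y : n.+1.-tuple T => (\int[P]_t F y t)%E).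
  exact: (measurable_fun_fubini_tonelli_F _ mF).
have dec (G : n.+1.-tuple T -> \bar R) : measurable_fun setT G ->
    (forall y, (0 <= G y)%E) ->
    (\int[iid P n.+1]_y G y =
     \int[P]_t \int[iid P n]_y G (tuple_cons (t, y)))%E.
  move=> mG G0.
  transitivity (\int[(P \x iid P n)%E]_z G (tuple_cons z))%E.
    exact: (@ge0_integral_distribution _ _ _ _ _ (P \x iid P n)%E (@tuple_cons
      _ T n)).
  apply: (fubini_tonelli1 (G \o @tuple_cons _ T n)); last by move=> z;
    exact: G0.
  by apply: measurableT_comp => //; exact: measurable_tuple_cons.
rewrite (dec _ mFn); last by move=> y; exact: F0.
rewrite (dec _ mFi); last by move=> y; apply: integral_ge0 => t _; exact: F0.
case: i ni Fdep mFn => [_ Fdep _|i ni Fdep _].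
  (* For [i = 0] the value of [F] is the same at every tuple, so an arbitrary [y0] serves and both
     sides reduce to one integral over [P]. *)
  pose y0 : n.+1.-tuple T := [tuple of nseq n.+1 x0].
  have FE y t : F y t = F y0 t by exact: Fdep.
  under eq_integral.
    move=> t _; under eq_integral do rewrite FE /=; rewrite integral_prob_cst;
      over.
  under [RHS]eq_integral.
    move=> t _; under eq_integral.
      by move=> y _; under eq_integral do rewrite FE; over.
    rewrite integral_prob_cst; over.
  by rewrite integral_prob_cst.
apply: eq_integral => t _.
apply: (IH i (fun y u => F (tuple_cons (t, y)) u)) => //.
  have h : measurable_fun setT (fun z : n.-tuple T * T => ((t, z.1), z.2)).
    by apply: measurable_fun_pair => //; apply: measurable_fun_pair.
  exact: (measurableT_comp mFc h).
move=> y y' u yy'; apply: Fdep => -[//|j] ji /=; exact: yy'.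
Qed.

(** * Adaptive answers *)

Section kernel_at.
Context d d' (X : measurableType d) (Y : measurableType d') (R : realType).
Variables (k : R.-pker X ~> Y) (x : X).

(** The measure [k x] repackaged as a probability, so that Tonelli's theorem applies to it. *)
Definition kernel_at (V : set Y) : \bar R := k x V.

Let kernel_at0 : kernel_at set0 = 0%E. Proof. exact: measure0. Qed.

Let kernel_at_ge0 V : (0 <= kernel_at V)%E. Proof. exact: measure_ge0. Qed.

Let kernel_at_sigma_additive : semi_sigma_additive kernel_at.
Proof. exact: measure_semi_sigma_additive. Qed.

HB.instance Definition _ := isMeasure.Build _ _ _ kernel_at
  kernel_at0 kernel_at_ge0 kernel_at_sigma_additive.

Let kernel_atT : kernel_at setT = 1%E. Proof. exact: prob_kernel. Qed.

HB.instance Definition _ :=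
  Measure_isProbability.Build _ _ _ kernel_at kernel_atT.

Lemma integral_kernel_at (f : Y -> \bar R) :
  (\int[k x]_y f y = \int[kernel_at]_y f y)%E.
Proof. exact: eq_measure_integral. Qed.

End kernel_at.

Section kernel_pull.
Context d d' d'' (X : measurableType d) (Y : measurableType d')
  (Z : measurableType d'') (R : realType).
Variables (phi : X -> Y) (k : R.-pker Y ~> Z).

(** The measurability proof is an argument so that the kernel structure can be attached to the term
    itself. *)
Definition kernel_pull of measurable_fun setT phi :=
  fun x => k (phi x) : {measure set Z -> \bar R}.

Hypothesis mphi : measurable_fun setT phi.

Let measurable_kernel_pull V : measurable V ->
  measurable_fun setT ((kernel_pull mphi) ^~ V).
Proof. by move=> mV; exact: (measurableT_comp (measurable_kernel k _ mV) mphi).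
  Qed.

HB.instance Definition _ := isKernel.Build _ _ X Z R
  (kernel_pull mphi) measurable_kernel_pull.

Let kernel_pullT x : kernel_pull mphi x setT = 1%E.
Proof. exact: prob_kernel. Qed.

HB.instance Definition _ := Kernel_isProbability.Build _ _ X Z R
  (kernel_pull mphi) kernel_pullT.

Lemma measurable_integral_kernel_pull (f : X * Z -> \bar R) :
  (forall z, (0 <= f z)%E) -> measurable_fun setT f ->
  measurable_fun setT (fun x => (\int[k (phi x)]_z f (x, z))%E).
Proof.
move=> f0 mf.
exact: (measurable_fun_integral_finite_kernel f (kernel_pull mphi)).
Qed.

End kernel_pull.
Arguments measurable_integral_kernel_pull {d d' d'' X Y Z R phi} k mphi f.

Section continuation.
Context {R : realType} {dU : measure_display} {U : measurableType dU}.
Variables (A : {mfun (U * random_string)%type >-> R}).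
Variable q : forall i : nat, R.-pker (i.-tuple R) ~> U.
Variables (N : probability R R) (f : forall i, i.-tuple R -> \bar R).
Hypotheses (f0 : forall i h, (0 <= f (i := i) h)%E)
  (mf : forall i, measurable_fun setT (@f i)).

Definition snoc i (h : i.-tuple R) (a : R) : i.+1.-tuple R := [tuple of rcons h
  a].

Lemma measurable_snoc d (T : measurableType d) i (h : T -> i.-tuple R)
    (a : T -> R) :
  measurable_fun setT h -> measurable_fun setT a ->
  measurable_fun setT (fun w => snoc (h w) (a w)).
Proof.
move=> mh ma; apply/measurable_fun_tnthP => j.
rewrite (_ : _ \o _ = fun w => if (j < i)%N then (h w)`_j else a w).
  by case: (j < i)%N => //;
    exact: (measurableT_comp (@measurable_tuple_nth R i j) mh).
apply/funext => w /=; rewrite (tnth_nth 0) /= nth_rcons size_tuple.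
case: ltnP => // ij; rewrite ifT//.
by rewrite eqn_leq ij andbT -ltnS ltn_ord.
Qed.

(* Conditional expectation of [f] of the final history, with [n] answers still
   to come, given the random string and the history so far. *)
Fixpoint cont n i (r : random_string) (h : i.-tuple R) : \bar R :=
  match n with
  | 0 => f h
  | n'.+1 => (\int[q i h]_x \int[N]_y cont n' r (snoc h (A (x, r) + y)%R))%E
  end.

Lemma cont_ge0 n i r (h : i.-tuple R) : (0 <= cont n r h)%E.
Proof.
by case: n => [|n] //=; apply: integral_ge0 => x _; apply: integral_ge0 => y _;
  elim: n i h x y => [|n IH] i h x y //=; apply: integral_ge0 => x' _;
  apply: integral_ge0 => y' _; exact: IH.
Qed.

Lemma measurable_cont n i d (T : measurableType d) (r : T -> random_string)
    (h : T -> i.-tuple R) :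
  measurable_fun setT r -> measurable_fun setT h ->
  measurable_fun setT (fun w => cont n (r w) (h w)).
Proof.
elim: n i d T r h => [|n IH] i d T r h mr mh /=.
  exact: (measurableT_comp (mf (i := i)) mh).
apply: (measurable_integral_kernel_pull (q i) mh
  (fun p => (\int[N]_y cont n (r p.1) (snoc (h p.1) (A (p.2, r p.1) +
    y)%R))%E)).
  by move=> p; apply: integral_ge0 => y _; exact: cont_ge0.
apply: (measurable_fun_fubini_tonelli_F
  (fun p => cont n (r p.1.1) (snoc (h p.1.1) (A (p.1.2, r p.1.1) + p.2)%R))).
  apply: IH; first by apply: (measurableT_comp mr); exact: measurableT_comp.
  apply: measurable_snoc; first by apply: (measurableT_comp mh);
    exact: measurableT_comp.
  apply: measurable_funD => //; apply: (measurableT_comp (measurable_funPT A)).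
  apply: measurable_fun_pair; first exact: (measurableT_comp measurable_snd).
  by apply: (measurableT_comp mr); exact: measurableT_comp.
by move=> p; exact: cont_ge0.
Qed.

Section answers.
Variable k : nat.

Lemma integral_answers0 (z : random_string * k.-tuple R)
    (g : 0.-tuple R -> \bar R) :
  measurable_fun setT g ->
  (\int[answers k A q 0 z]_h g h = g [tuple])%E.
Proof.
by move=> mg; rewrite /= /kdirac integral_dirac// diracT mul1e.
Qed.

Lemma integral_answersS i (z : random_string * k.-tuple R)
    (g : i.+1.-tuple R -> \bar R) :
  measurable_fun setT g -> (forall h, (0 <= g h)%E) ->
  (\int[answers k A q i.+1 z]_h g h =
   \int[answers k A q i z]_h \int[q i h]_x
     g (snoc h (A (x, z.1) + z.2`_i)%R))%E.
Proof.
move=> mg g0 /=.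
rewrite [LHS](@integral_kcomp _ _ _ _ _ _ R (answers k A q i) _ z g g0 mg).
apply: eq_integral => h _.
rewrite [LHS](@integral_kcomp _ _ _ _ _ _ R (@next_query _ _ _ k q i) _ (z, h)
  g g0 mg).
rewrite /next_query; apply: eq_integral => x _.
by rewrite /kdirac integral_dirac// diracT mul1e.
Qed.

Lemma integral_answers_dep i r (y y' : k.-tuple R) (g : i.-tuple R -> \bar R) :
  measurable_fun setT g -> (forall h, (0 <= g h)%E) ->
  (forall j, (j < i)%N -> y`_j = y'`_j) ->
  (\int[answers k A q i (r, y)]_h g h = \int[answers k A q i (r, y')]_h g h)%E.
Proof.
elim: i g => [|i IH] g mg g0 yy'; first by rewrite !integral_answers0.
rewrite !integral_answersS//= yy'//; apply: IH.
- apply: (measurable_integral_kernel_pull (q i) (@measurable_id _ _ setT)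
    (fun p => g (snoc p.1 (A (p.2, r) + y'`_i)))) => //.
  apply: (measurableT_comp mg); apply: measurable_snoc => //.
  apply: measurable_funD => //; apply: (measurableT_comp (measurable_funPT A)).
  exact: measurable_fun_pair.
- by move=> h; exact: integral_ge0.
- by move=> j ji; apply: yy'; rewrite ltnW.
Qed.

(** Noise drawn in advance as a vector is exchanged for noise drawn afresh with each answer. The
    first [i] answers read only the first [i] noise coordinates, so coordinate [i] is still fresh
    and its integral can be moved inside, next to the answer that uses it. *)
Lemma integral_answers_cont r i : (i <= k)%N ->
  (\int[iid N k]_y \int[answers k A q i (r, y)]_h cont (k - i) r h =
   cont k r ([tuple] : 0.-tuple R))%E.
Proof.
elim: i => [|i IH] ik.
  under eq_integral.
    move=> y _; rewrite integral_answers0; last first.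
      by apply: measurable_cont => //; exact: measurable_cst.
    over.
  by rewrite integral_prob_cst subn0.
rewrite -(IH (ltnW ik)) -(subnSK ik) /=; set m := (k - i.+1)%N.
pose G h t := (\int[q i h]_x cont m r (snoc h (A (x, r) + t)%R))%E.
have mA d (T : measurableType d) (x : T -> U) (t : T -> R) :
    measurable_fun setT x -> measurable_fun setT t ->
    measurable_fun setT (fun w => A (x w, r) + t w).
  move=> mx mt; apply: measurable_funD => //.
  by apply: (measurableT_comp (measurable_funPT A)); exact: measurable_fun_pair.
have mG d (T : measurableType d) (h : T -> i.-tuple R) (t : T -> R) :
    measurable_fun setT h -> measurable_fun setT t ->
    measurable_fun setT (fun w => G (h w) (t w)).
  move=> mh mt; apply: (measurable_integral_kernel_pull (q i) mh
    (fun p => cont m r (snoc (h p.1) (A (p.2, r) + t p.1)%R))).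
    by move=> p; exact: cont_ge0.
  apply: measurable_cont => //; apply: measurable_snoc.
    exact: (measurableT_comp mh).
  by apply: mA => //; exact: (measurableT_comp mt).
have G0 h t : (0 <= G h t)%E by apply: integral_ge0 => x _; exact: cont_ge0.
(* Here [t] stands for the noise of answer number [i], separated from the vector [y] that produced
   the history. *)
pose F y t := (\int[answers k A q i (r, y)]_h G h t)%E.
transitivity (\int[iid N k]_y F y y`_i)%E.
  apply: eq_integral => y _; rewrite integral_answersS//.
    by apply: measurable_cont.
  by move=> h; exact: cont_ge0.
rewrite (@iid_integral_nth _ _ R N 0 k i F ik).
- apply: eq_integral => y _; rewrite /F.
  under eq_integral do rewrite integral_kernel_at.
  rewrite -(fubini_tonelli (fun p => G p.1 p.2)
    (m1 := kernel_at (answers k A q i) (r, y)))//; last exact: mG.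
  rewrite integral_kernel_at; apply: eq_integral => h _.
  rewrite integral_kernel_at (fubini_tonelli
    (fun p => cont m r (snoc h (A (p.1, r) + p.2)%R)) (m1 := kernel_at (q i)
      h)).
  + by apply: eq_integral => t _; rewrite /G integral_kernel_at.
  + by apply: measurable_cont => //; apply: measurable_snoc => //; exact: mA.
  + by move=> p; exact: cont_ge0.
- have mry : measurable_fun setT (fun z : k.-tuple R * R => (r, z.1)).
    exact: measurable_fun_pair.
  apply: (measurable_integral_kernel_pull (answers k A q i) mry
    (fun p => G p.2 p.1.2)) => //.
  by apply: mG => //; exact: measurableT_comp.
- by move=> y t; exact: integral_ge0.
- move=> y y' t yy'; apply: integral_answers_dep => //.
  exact: mG.
Qed.

Lemma integral_adaptive_release (mu : probability random_string R) V :
  measurable V -> (forall h : k.-tuple R, f h = (\1_V h)%:E) ->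
  adaptive_release k A q mu N V = (\int[mu]_r cont k r ([tuple] : 0.-tuple
    R))%E.
Proof.
move=> mV fV; rewrite /adaptive_release /= /kmix.
rewrite (fubini_tonelli1 (fun z => answers k A q k z V))//; last first.
  exact: (measurable_kernel (answers k A q k)).
apply: eq_integral => r _.
rewrite -(integral_answers_cont r (leqnn k)) subnn.
apply: eq_integral => y _ /=.
under eq_integral do rewrite fV.
by rewrite integral_indic// setIT.
Qed.

End answers.
End continuation.

(** * Trading the shift of the noise for a density *)

Section reweighting.
Context {R : realType} {dU : measure_display} {U : measurableType dU}.
Variable q : forall i : nat, R.-pker (i.-tuple R) ~> U.
Variables (b : R) (mu : probability random_string R)
  (f : forall i, i.-tuple R -> \bar R).
Hypotheses (b0 : 0 < b) (f0 : forall i h, (0 <= f (i := i) h)%E)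
  (mf : forall i, measurable_fun setT (@f i)).

(* Density at [L] of the noisy answers, given the random string, with respect to
   noise alone; [L] lists the pairs of a query and its answer. *)
Definition weight (A : {mfun (U * random_string)%type >-> R})
    (L : seq (U * R)) (r : random_string) : R :=
  expR (\sum_(p <- L) (`|p.2| - `|p.2 - A (p.1, r)|) / b).

(** A hybrid of the two descriptions of the release: the pairs in [L] are already fixed and enter
    through their density, while the [n] remaining answers are still generated from the random
    string. The string is averaged over both factors jointly. *)
Definition weighted_cont A n i L (h : i.-tuple R) : \bar R :=
  (\int[mu]_r ((weight A L r)%:E * cont A q (laplace b) f n r h))%E.

Let measurable_shift (A : {mfun (U * random_string)%type >-> R}) d
    (T : measurableType d) (x : T -> U) (a : T -> R) (r : T -> random_string) :
  measurable_fun setT x -> measurable_fun setT a -> measurable_fun setT r ->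
  measurable_fun setT (fun w => (`|a w| - `|a w - A (x w, r w)|) / b).
Proof.
move=> mx ma mr; apply: measurable_funM => //; apply: measurable_funB.
  exact: (measurableT_comp (@normr_measurable R setT)).
apply: (measurableT_comp (@normr_measurable R setT));
  apply: measurable_funB => //.
by apply: (measurableT_comp (measurable_funPT A)); exact: measurable_fun_pair.
Qed.

Let measurable_weight (A : {mfun (U * random_string)%type >-> R}) d
    (T : measurableType d) L (r : T -> random_string) :
  measurable_fun setT r -> measurable_fun setT (fun w => (weight A L (r w))%:E).
Proof.
move=> mr; apply/measurable_EFinP;
  apply: (measurableT_comp (@measurable_expR R)).
by apply: measurable_sum => p; exact: measurable_shift.
Qed.

Let measurable_step A n i L (h : i.-tuple R) d (T : measurableType d)
    (x : T -> U) (a : T -> R) (r : T -> random_string) :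
  measurable_fun setT x -> measurable_fun setT a -> measurable_fun setT r ->
  measurable_fun setT (fun w => (weight A ((x w, a w) :: L) (r w))%:E *
    cont A q (laplace b) f n (r w) (snoc h (a w)))%E.
Proof.
move=> mx ma mr; apply: emeasurable_funM; last first.
  by apply: measurable_cont => //; exact: measurable_snoc.
apply/measurable_EFinP; apply: (measurableT_comp (@measurable_expR R)).
under eq_fun do rewrite big_cons /=.
apply: measurable_funD; first exact: measurable_shift.
by apply: measurable_sum => p; exact: measurable_shift.
Qed.

Let step_ge0 A n i L (h : i.-tuple R) r :
  (0 <= (weight A L r)%:E * cont A q (laplace b) f n r h)%E.
Proof. by rewrite mule_ge0 ?cont_ge0// lee_fin expR_ge0. Qed.

Let measurable_next A n i L (h : i.-tuple R) :
  measurable_fun setT (fun p : U * R =>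
    weighted_cont A n ((p.1, p.2) :: L) (snoc h p.2)).
Proof.
apply: (measurable_fun_fubini_tonelli_F (fun z : (U * R) * random_string =>
  (weight A ((z.1.1, z.1.2) :: L) z.2)%:E *
  cont A q (laplace b) f n z.2 (snoc h z.1.2))%E) => //.
by apply: measurable_step => //; exact: measurableT_comp.
Qed.

(* The shift of the noise by the answer becomes a density, so that fresh answers
   no longer depend on the random string and Fubini applies. *)
Lemma weighted_contS A n i L (h : i.-tuple R) :
  weighted_cont A n.+1 L h =
  (\int[kernel_at (q i) h]_x \int[laplace b]_a
    weighted_cont A n ((x, a) :: L) (snoc h a))%E.
Proof.
pose J x a r := ((weight A ((x, a) :: L) r)%:E *
  cont A q (laplace b) f n r (snoc h a))%E.
have mc r : measurable_fun setT (fun a =>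
  cont A q (laplace b) f n r (snoc h a)).
  by apply: measurable_cont => //; exact: measurable_snoc.
have mJ d (T : measurableType d) (x : T -> U) (a : T -> R)
    (r : T -> random_string) :
    measurable_fun setT x -> measurable_fun setT a -> measurable_fun setT r ->
    measurable_fun setT (fun w => J (x w) (a w) (r w)).
  by move=> mx ma mr; exact: measurable_step.
have J0 x a r : (0 <= J x a r)%E by exact: step_ge0.
transitivity (\int[mu]_r \int[kernel_at (q i) h]_x \int[laplace b]_a J x a r)%E.
  apply: eq_integral => r _ /=; rewrite integral_kernel_at.
  rewrite -ge0_integralZl//; first last.
  - by rewrite lee_fin expR_ge0.
  - by move=> x _; apply: integral_ge0 => y _; exact: cont_ge0.
  - apply: (measurable_fun_fubini_tonelli_F (fun p =>
      cont A q (laplace b) f n r (snoc h (A (p.1, r) + p.2)))).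
      apply: measurable_cont => //; apply: measurable_snoc => //.
      apply: measurable_funD => //;
        apply: (measurableT_comp (measurable_funPT A)).
      exact: measurable_fun_pair.
    by move=> p; exact: cont_ge0.
  apply: eq_integral => x _.
  rewrite (integral_laplace_addl _ b0 (mc r)); last by move=> a;
    exact: cont_ge0.
  rewrite -ge0_integralZl//; first last.
  - by rewrite lee_fin expR_ge0.
  - by move=> a _; rewrite mule_ge0 ?cont_ge0// lee_fin expR_ge0.
  - apply: emeasurable_funM => //; apply/measurable_EFinP.
    by apply: (measurableT_comp (@measurable_expR R));
      apply: (@measurable_shift A _ _ (fun=> x) id (fun=> r)).
  apply: eq_integral => a _; rewrite /J /weight big_cons /= expRD EFinM.
  by rewrite (muleC (cont _ _ _ _ _ _ _)) muleA; congr (_ * _)%E; exact: muleC.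
rewrite (fubini_tonelli (fun p : random_string * U =>
  (\int[laplace b]_a J p.2 a p.1)%E))//; first last.
- by move=> p; exact: integral_ge0.
- apply: (measurable_fun_fubini_tonelli_F (fun p : (random_string * U) * R => J
    p.1.2 p.2 p.1.1)) => //.
  by apply: mJ => //; exact: measurableT_comp.
apply: eq_integral => x _ /=.
rewrite (fubini_tonelli (fun p => J x p.2 p.1))//.
exact: mJ.
Qed.

(** With no answers left, [f h] is constant in the random string and factors out, which leaves the
    bound on weights. Otherwise both sides are integrals against the same query law and the same
    pure noise, so the inequality can be integrated pointwise. *)
Lemma weighted_cont_le A A' (K : R) k : 0 <= K ->
  (forall L, size L = k ->
    (\int[mu]_r (weight A L r)%:E <= K%:E * \int[mu]_r (weight A' L r)%:E)%E) ->
  forall n i L (h : i.-tuple R), (size L + n)%N = k ->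
    (weighted_cont A n L h <= K%:E * weighted_cont A' n L h)%E.
Proof.
move=> K0 wk; elim=> [|n IH] i L h Lk.
  rewrite /weighted_cont /=.
  under eq_integral do rewrite muleC.
  under [in leRHS]eq_integral do rewrite muleC.
  rewrite !ge0_integralZl//; try exact: measurable_weight;
    try by move=> r _; rewrite lee_fin expR_ge0.
  by rewrite muleCA lee_wpmul2l// wk// -Lk addn0.
rewrite (weighted_contS A) (weighted_contS A').
have mF B : measurable_fun setT (fun x : U =>
    \int[laplace b]_a weighted_cont B n ((x, a) :: L) (snoc h a))%E.
  apply: (measurable_fun_fubini_tonelli_F (fun p : U * R =>
    weighted_cont B n ((p.1, p.2) :: L) (snoc h p.2))) => //.
  by move=> p; apply: integral_ge0 => r _; exact: step_ge0.
have F0 B x a : (0 <= weighted_cont B n ((x, a) :: L) (snoc h a))%E.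
  by apply: integral_ge0 => r _; exact: step_ge0.
have mG B x : measurable_fun setT (fun a =>
  weighted_cont B n ((x, a) :: L) (snoc h a)).
  have hx : measurable_fun setT (fun a : R =>
    (x, a)) by exact: measurable_fun_pair.
  exact: (measurableT_comp (measurable_next B n L h) hx).
rewrite -ge0_integralZl//; last by move=> x _; exact: integral_ge0.
apply: ge0_le_integral => //.
- by move=> x _; exact: integral_ge0.
- exact: measurable_funeM.
move=> x _; rewrite -ge0_integralZl//.
apply: ge0_le_integral => //.
- exact: measurable_funeM.
- by move=> a _; apply: IH; rewrite /= addSnnS.
Qed.

End reweighting.

Section release.
Context {R : realType} {dU : measure_display} {U : measurableType dU}.
Variable q : forall i : nat, R.-pker (i.-tuple R) ~> U.
Variables (k : nat) (mu : probability random_string R).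

Lemma adaptive_releaseE (V : set (k.-tuple R)) : measurable V ->
  exists f : forall i, i.-tuple R -> \bar R,
    [/\ forall i (h : i.-tuple R), (0 <= f i h)%E,
        forall i, measurable_fun setT (f i) &
        forall (A : {mfun (U * random_string)%type >-> R}) N,
          adaptive_release k A q mu N V =
          (\int[mu]_r cont A q N f k r ([tuple] : 0.-tuple R))%E].
Proof.
(* [cont] takes a function at every history length. Comparing underlying sequences gives the
   indicator of [V] at length [k] and zero at other lengths, without a cast between tuple types. *)
move=> mV; pose f i (h : i.-tuple R) : \bar R :=
  (\1_[set h : i.-tuple R | exists2 v, V v & tval v = tval h] h)%:E.
have fE (h : k.-tuple R) : f k h = (\1_V h)%:E.
  rewrite /f (_ : [set _ | _] = V)//; apply/seteqP; split => v /=.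
    by move=> [u Vu] /val_inj <-.
  by move=> Vv; exists v.
have f0 i (h : i.-tuple R) : (0 <= f i h)%E by rewrite lee_fin.
have mf i : measurable_fun setT (f i).
  have [<-|ik] := eqVneq k i.
    rewrite (_ : f k = EFin \o \1_V); last by apply/funext => h; exact: fE.
    by apply/measurable_EFinP; exact: measurable_indic.
  rewrite (_ : f i = cst 0%E); first exact: measurable_cst.
  apply/funext => h; rewrite /f (_ : [set _ | _] = set0) ?indic0//.
  apply/seteqP; split => v //= -[u _ uv].
  by move: ik; rewrite -(size_tuple u) uv size_tuple eqxx.
by exists f; split => // A N; exact: integral_adaptive_release.
Qed.

Lemma adaptive_release_le (b K : R)
    (A A' : {mfun (U * random_string)%type >-> R}) V :
  0 < b -> 0 <= K -> measurable V ->
  (forall L, size L = k ->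
    (\int[mu]_r (weight b A L r)%:E <= K%:E * \int[mu]_r (weight b A' L
      r)%:E)%E) ->
  (adaptive_release k A q mu (laplace b) V <=
    K%:E * adaptive_release k A' q mu (laplace b) V)%E.
Proof.
move=> b0 K0 mV wk; have [f [f0 mf E]] := adaptive_releaseE mV; rewrite !E.
(* With nothing fixed yet the weight is an empty product, equal to 1, and [weighted_cont] is the
   release itself. *)
have := @weighted_cont_le _ _ _ q b mu f b0 f0 mf A A' K k K0 wk k 0%N [::]
  [tuple] (add0n k).
rewrite /weighted_cont /weight.
under eq_integral do rewrite big_nil expR0 mul1e.
by under [X in (_ <= _ * X)%E -> _]eq_integral do rewrite big_nil expR0 mul1e.
Qed.

(** This serves the zero noise scale, where a shift has no density. The exceptional null set is
    common to all queries, because an adaptive query may be any element of [U]. *)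
Lemma adaptive_release_ae_eq (N : probability R R)
    (A A' : {mfun (U * random_string)%type >-> R}) V : measurable V ->
  {ae mu, forall r, forall x, A (x, r) = A' (x, r)} ->
  adaptive_release k A q mu N V = adaptive_release k A' q mu N V.
Proof.
move=> mV AA'; have [f [f0 mf E]] := adaptive_releaseE mV; rewrite !E.
have mcont (B : {mfun (U * random_string)%type >-> R}) :
    measurable_fun setT (fun r => cont B q N f k r ([tuple] : 0.-tuple R)).
  by apply: measurable_cont => //; exact: measurable_cst.
apply: ge0_ae_eq_integral => //; try by move=> r _; exact: cont_ge0.
apply: filterS AA' => r Ar _.
elim: k 0%N ([tuple] : 0.-tuple R) => [//|n IH] i h /=.
apply: eq_integral => x _; apply: eq_integral => y _.
by rewrite Ar IH.
Qed.

End release.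

(** * From the subexponential diameter to tail bounds *)

Section subexp_diameter.
Context d (T : measurableType d) (R : realType) (P : probability T R) (X : T ->
  R).
Hypothesis mX : measurable_fun setT X.

Let mlevel (t : R) : measurable [set w | t <= `|X w|].
Proof.
rewrite -[X in measurable X]setTI; apply: measurable_fun_le => //.
exact: (measurableT_comp (@normr_measurable R setT)).
Qed.

Lemma subexp_diameter_lt_tail (D s : R) :
  (subexp_diameter P X <= D%:E)%E -> D < s -> subexp_tail P s X.
Proof.
move=> XD Ds.
have /ereal_inf_lt[_ [s' [s'0 tX] <-]] : (subexp_diameter P X < s%:E)%E.
  by apply: le_lt_trans XD _; rewrite lte_fin.
rewrite lte_fin => s's t t0; apply: le_trans (tX _ t0) _.
rewrite lee_fin ler_pM2l// ler_expR lerN2 ler_pM2l//.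
by rewrite lef_pV2 ?posrE ?ltW// (lt_trans s'0).
Qed.

(** The infimum is attained: every scale above [D] satisfies the tail bound, and the bound is
    continuous in the scale at [D > 0]. *)
Lemma subexp_diameter_le_tail (D : R) : 0 < D ->
  (subexp_diameter P X <= D%:E)%E -> subexp_tail P D X.
Proof.
move=> D0 XD t t0; set p := P _.
have pfin : p \is a fin_num by exact: fin_num_measure.
rewrite -(fineK pfin) lee_fin.
apply: (@ler_cvg_to _ (D^'+) _ R (fun=> fine p) (fun s =>
  2 * expR (- (t / s)))).
- exact: cvg_cst.
- apply: cvgMr; apply/cvg_at_right_filter.
  apply: (@continuous_comp _ _ _ (fun s : R => - (t / s)) expR);
    last exact: continuous_expR.
  apply: continuousN; apply: continuousM; first exact: cst_continuous.
  by apply: inv_continuous; rewrite lt0r_neq0.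
- near=> s; rewrite -lee_fin fineK//.
  by apply: (subexp_diameter_lt_tail XD) t0; near: s; exact: nbhs_right_gt.
Unshelve. all: by end_near. Qed.

Lemma subexp_diameter_le0_ae :
  (subexp_diameter P X <= 0)%E -> P.-negligible [set w | X w != 0].
Proof.
move=> X0.
have tail0 (t : R) : 0 < t -> P [set w | t <= `|X w|] = 0%E.
  move=> t0; apply/eqP; rewrite eq_le measure_ge0 andbT.
  apply/lee_addgt0Pr => e e0; rewrite add0e.
  (* At scale [t * e / 2] the tail bound is [2 * expR (- (2 / e))], which is at most [e] because
     [expR x >= x]. *)
  have s0 : 0 < t * e / 2 by rewrite divr_gt0// mulr_gt0.
  apply: le_trans (subexp_diameter_lt_tail X0 s0 t0) _.
  rewrite lee_fin expRN ler_pdivrMr ?expR_gt0//.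
  apply: (@le_trans _ _ (e * (t / (t * e / 2)))).
    rewrite (_ : e * _ = 2)//.
    by field; rewrite !lt0r_neq0.
  rewrite ler_pM2l//; apply: le_trans (expR_ge1Dx _); rewrite lerDr//.
apply: (@negligibleS _ _ _ _ (\bigcup_n [set w | n.+1%:R^-1 <= `|X w|]));
  last first.
  apply: negligible_bigcup => n; exists [set w | n.+1%:R^-1 <= `|X w|].
  by split => //; apply: tail0; rewrite invr_gt0.
move=> w /= Xw; have Xw0 : 0 < `|X w| by rewrite normr_gt0.
have [n _ /(_ n (leqnn n)) nX] := near_infty_natSinv_lt (PosNum Xw0).
by exists n => //=; exact: ltW.
Unshelve. all: by end_near. Qed.

End subexp_diameter.

(** * Privacy of the adaptive release *)

Section privacy_of_release.
Context (R : realType) (Data : Type) (nbr : Data -> Data -> Prop).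
Hypothesis nbr_sym : forall D D' : Data, nbr D D' -> nbr D' D.
Context (dU : measure_display) (U : measurableType dU).
Hypothesis U_countable : countable [set: U].
Variable mu : probability random_string R.
Variable A : Data -> {mfun (U * random_string)%type >-> R}.
Variables (Delta1 Delta2 : R) (g : Data -> U -> R).
Hypotheses (Delta1_ge0 : 0 <= Delta1) (Delta2_ge0 : 0 <= Delta2).
Hypothesis g_sensitivity : forall x : U,
  (global_sensitivity nbr (fun D => g D x) <= Delta1%:E)%E.
Hypothesis A_subexp : forall (D : Data) (x : U),
  (subexp_diameter mu (fun r => A D (x, r) - g D x)%R <= Delta2%:E)%E.

Let g_le D D' x : nbr D D' -> `|g D x - g D' x| <= Delta1.
Proof.
move=> DD'; rewrite -lee_fin; apply: le_trans (g_sensitivity x).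
by apply: ereal_sup_ubound; exists D, D'.
Qed.

Let mA D x : measurable_fun setT (fun r => A D (x, r)).
Proof. by apply: (measurableT_comp (measurable_funPT (A D)));
  exact: measurable_fun_pair. Qed.

(** For each query the exceptional strings form a null set; since [U] is countable, their union over
    all queries is still null. [B n] collects the exceptional strings of the query coded by [n]. *)
Lemma ae_eq_of_subexp0 D : Delta2 = 0 ->
  {ae mu, forall r, forall x, A D (x, r) = g D x}.
Proof.
move=> D20; have [e einj] : exists e : U -> nat, injective e.
  have /countable_injP[e inj] := U_countable.
  by exists e => x y xy; apply: inj; rewrite ?inE.
pose B n := [set r | exists x, e x = n /\ A D (x, r) != g D x].
apply: (@negligibleS _ _ _ _ (\bigcup_n B n)); last first.
  apply: negligible_bigcup => n.
  have [[x xn]|nx] := pselect (exists x, e x = n); last first.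
    rewrite (_ : B n = set0); first exact: negligible_set0.
    by apply/seteqP; split => r //= -[x [xn _]]; apply: nx; exists x.
  have mX : measurable_fun setT (fun r => A D (x, r) - g D x).
    exact: measurable_funB.
  apply: negligibleS (subexp_diameter_le0_ae mX _).
    move=> r [y [yn yr]] /=; rewrite subr_eq0.
    by have -> : x = y by apply: einj; rewrite xn yn.
  by apply: le_trans (A_subexp D x) _; rewrite D20.
by move=> r /= /existsNP[x /eqP xr]; exists (e x) => //; exists x.
Qed.

(* When [Delta2 = 0] there is no tail at scale [Delta2], but [1 + 4 ln 2] leaves
   room for [s = Delta1 / 2]. *)
Lemma exists_subexp_tail : 0 < Delta1 + Delta2 ->
  exists s, [/\ 0 < s, s <= Delta1 + Delta2,
    Delta1 + s * (1 + 4 * ln 2) <= (1 + 4 * ln 2) * (Delta1 + Delta2) &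
    forall D x, subexp_tail mu s (fun r => A D (x, r) - g D x)].
Proof.
(* This is [ln (1 + x) <= x] at [x = -1/2]. The choice [Delta1 / 2] below needs
   [1 + 4 * ln 2 >= 2]. *)
move=> Dp; have ln2 : 2^-1 <= ln 2 :> R.
  have := @le_ln1Dx R (- 2^-1); rewrite (_ : 1 - 2^-1 = 2^-1); last by field.
  by rewrite lnV ?posrE// lerN2; apply; lra.
move: Delta2_ge0; rewrite le_eqVlt => /orP[/eqP D20|D20]; last first.
  exists Delta2; split => //; first by rewrite lerDr.
    by move: Delta1_ge0; nra.
  by move=> D' x; apply: subexp_diameter_le_tail => //; exact: measurable_funB.
have D10 : 0 < Delta1 by move: Dp; rewrite -D20 addr0.
exists (Delta1 / 2); split.
- lra.
- lra.
- by nra.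
- by move=> D' x; apply: (subexp_diameter_lt_tail (A_subexp D' x)); lra.
Qed.

(** Stated for any [c >= 1 + 4 * ln 2] and any number of answers, so that both claims of the theorem
    are instances. *)
Lemma adaptive_release_private (k : nat)
    (q : forall i : nat, R.-pker (i.-tuple R) ~> U) (eps c : R) :
  (0 < k)%N -> 0 < eps -> 1 + 4 * ln 2 <= c -> eps <= c / 2 ->
  differentially_private nbr eps (fun D =>
    adaptive_release k (A D) q mu (laplace (c * (Delta1 + Delta2) * k%:R /
      eps))).
Proof.
move=> k0 e0 c1 ec; set b := c * _ * _ / _.
have l20 : 0 <= ln 2 :> R by rewrite ln_ge0// ler1n.
have c0 : 0 < c by apply: lt_le_trans c1; rewrite ltr_wpDr// mulr_ge0.
(* Symmetry of [nbr] yields the lower bound from the upper bound with the datasets exchanged. *)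
suff half V D D' : measurable V -> nbr D D' ->
    (adaptive_release k (A D) q mu (laplace b) V <=
     (expR eps)%:E * adaptive_release k (A D') q mu (laplace b) V)%E.
  move=> V mV D D' DD'; split; last exact: half.
  have := half V D' D mV (nbr_sym DD').
  move=> /(lee_wpmul2l (x := (expR (- eps))%:E)) H.
  apply: le_trans (H _) _; first by rewrite lee_fin expR_ge0.
  by rewrite muleA -EFinM -expRD addNr expR0 mul1e.
move=> mV DD'.
(* If both sensitivities vanish, the noise is a point mass; almost surely the answers equal [g],
   which agrees on neighbors, so the two releases have the same law. *)
have [Dp|] := ltP 0 (Delta1 + Delta2); last first.
  move=> Dn; have [D10 D20] : Delta1 = 0 /\ Delta2 = 0 by have := Delta1_ge0;
    have := Delta2_ge0; split; lra.
  rewrite (@adaptive_release_ae_eq _ _ _ q k mu (laplace b) (A D) (A D') V mV).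
    rewrite -[leLHS]mul1e lee_wpmul2r// lee_fin -expR0 ler_expR ltW//.
  apply: filterS2 (ae_eq_of_subexp0 D D20) (ae_eq_of_subexp0 D' D20) =>
    r Ar A'r x.
  rewrite Ar A'r; apply/eqP; rewrite -subr_eq0 -normr_le0 -D10.
  exact: g_le.
have [s [s0 sD sle tA]] := exists_subexp_tail Dp.
have kp : 0 < k%:R :> R by rewrite ltr0n.
have b0 : 0 < b by rewrite divr_gt0// !mulr_gt0.
(* The factor [k] in the noise scale cancels: the rate [l] does not depend on the number of
   answers. *)
have lE : k%:R / b = eps / (c * (Delta1 + Delta2)).
  by rewrite /b; field; rewrite !lt0r_neq0.
have l0 : 0 < k%:R / b by exact: divr_gt0.
have cD : 0 < c * (Delta1 + Delta2) by exact: mulr_gt0.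
(* As [s <= Delta1 + Delta2], the product is at most [eps / c]; the hypothesis [eps <= c / 2] enters
   here. *)
have ls : k%:R / b * s <= 2^-1.
  rewrite lE mulrAC ler_pdivrMr//.
  apply: (@le_trans _ _ (c / 2 * (Delta1 + Delta2)));
    last by rewrite mulrA (mulrC c).
  by apply: ler_pM => //; exact: ltW.
apply: adaptive_release_le => // L Lk.
rewrite /weight.
apply: (@weight_le _ _ _ mu _ s (k%:R / b) s0 l0 _ L
  (fun j r => A D (j.1, r)) (fun j r => A D' (j.1, r))
  (fun j => g D j.1) (fun j => g D' j.1) (fun j => j.2) Delta1).
- by apply: le_lt_trans ls _; rewrite invf_lt1// ltr1n.
- by rewrite Lk.
- by move=> j; exact: mA.
- by move=> j; exact: mA.
- by move=> j; exact: tA.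
- by move=> j; exact: tA.
- by move=> j; exact: g_le.
- by rewrite Lk.
- exact: ls.
- rewrite lE mulrAC ler_pdivrMr// ler_pM2l//.
  by apply: le_trans sle _; rewrite ler_pM2r.
Qed.

End privacy_of_release.

Theorem theorem1 (R : realType)
    (Data : Type) (nbr : Data -> Data -> Prop)
    (nbr_sym : forall D D' : Data, nbr D D' -> nbr D' D)
    (dU : measure_display) (U : measurableType dU)
    (U_countable : countable [set: U])
    (U_discrete : forall V : set U, measurable V)
    (mu : probability random_string R) (mu_uniform : uniform_string mu)
    (A : Data -> {mfun (U * random_string)%type >-> R})
    (Delta1 Delta2 : R) (Delta1_ge0 : 0 <= Delta1) (Delta2_ge0 : 0 <= Delta2)
    (g : Data -> U -> R)
    (g_sensitivity : forall x : U,
      (global_sensitivity nbr (fun D => g D x) <= Delta1%:E)%E)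
    (A_subexp : forall (D : Data) (x : U),
      (subexp_diameter mu (fun r => A D (x, r) - g D x)%R <= Delta2%:E)%E) :
  (forall (k : nat) (q : forall i : nat, R.-pker (i.-tuple R) ~> U) (eps : R),
    let c : R := 3 + 12 * ln 2 in
    (1 <= k)%N -> 0 < eps -> eps <= c / 6 ->
    differentially_private nbr eps (fun D =>
      adaptive_release k (A D) q mu
        (laplace (c * (Delta1 + Delta2) * k%:R / eps)))) /\
  (forall (q : forall i : nat, R.-pker (i.-tuple R) ~> U) (eps : R),
    let c : R := 1 + 4 * ln 2 in
    0 < eps -> eps <= c / 2 ->
    differentially_private nbr eps (fun D =>
      adaptive_release 1 (A D) q mu
        (laplace (c * (Delta1 + Delta2) * 1%:R / eps)))).
Proof.
have l20 : 0 <= ln 2 :> R by rewrite ln_ge0// ler1n.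
split=> [k q eps c k1 e0 ec|q eps c e0 ec].
(* Here [c] is three times [1 + 4 * ln 2], and [c / 6 <= c / 2]. *)
- by apply: (adaptive_release_private nbr_sym U_countable Delta1_ge0 Delta2_ge0
    g_sensitivity A_subexp) => //; rewrite /c in ec *; lra.
- exact: (adaptive_release_private nbr_sym U_countable Delta1_ge0 Delta2_ge0
    g_sensitivity A_subexp).
Qed.
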